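(* Let $(\theta,q)\in(0,1)\times(2,\infty]$ and $\alpha:=\frac{1-\theta}{2}$. Then there exists $f\in(C_b^0(\mathbb{R}),{\rm Lip}^0(\mathbb{R}))_{\theta,q}$ such that, with $F(t,x):=\mathbb{E}f(x+W_{1-t})$, $\varphi_t:=\frac{\partial F}{\partial x}(t,W_t)$ for $t\in[0,1)$ and $\mathcal I^\alpha_t\varphi:=\alpha\int_0^1(1-u)^{\alpha-1}\varphi_{u\wedge t}\,\mathrm{d}u$ for $t\in[0,1)$, one has \[ \mathcal I^\alpha\varphi-\varphi_0\notin\mathrm{BMO}_2([0,1)). \]
   Context: $(\Omega,\mathcal F,\mathbb P,(\mathcal F_t)_{t\in[0,1]})$ is a complete probability space with the augmented natural filtration of a standard one-dimensional Brownian motion $(W_t)_{t\in[0,1]}$ with $W_0\equiv0$ and continuous paths, $\mathcal F=\mathcal F_1$. $C_b^0(\mathbb{R})$ is the Banach space of bounded continuous $f:\mathbb{R}\to\mathbb{R}$ with $f(0)=0$ with the sup-norm; ${\rm Lip}^0(\mathbb{R})$ the space of Lipschitz $f$ with $f(0)=0$ normed by the Lipschitz constant. For Banach spaces $(E_0,E_1)$, $(E_0,E_1)_{\theta,q}$ is the real interpolation space of all $x\in E_0+E_1$ with $\|\lambda\mapsto\lambda^{-\theta}K(\lambda,x;E_0,E_1)\|_{L_q((0,\infty),\mathrm{d}\lambda/\lambda)}<\infty$, where $K(\lambda,x;E_0,E_1):=\inf\{\|x_0\|_{E_0}+\lambda\|x_1\|_{E_1}:x=x_0+x_1\}$. For an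 adapted càdlàg process $Y=(Y_t)_{t\in[0,1)}$ with $Y_t\in L_2$, $\|Y\|_{\mathrm{BMO}_2([0,1))}:=\sup_{a\in[0,1)}\big\|\big(\mathbb{E}[\sup_{a\le t<1}|Y_t-Y_{a-}|^2\mid\mathcal F_a]\big)^{1/2}\big\|_{L_\infty}$ with $Y_{0-}:=Y_0$, and $\mathrm{BMO}_2([0,1))$ is the space of such $Y$ with finite norm. *)

(* Defs.v *)
From HB Require Import structures.
From mathcomp Require Import all_boot all_order all_algebra.
From mathcomp Require Import all_classical all_reals all_analysis.
From mathcomp Require Import measurable_realfun.
Set Implicit Arguments. Unset Strict Implicit. Unset Printing Implicit Defensive.
Import Order.TTheory GRing.Theory Num.Theory.
Import numFieldNormedType.Exports.
Local Open Scope classical_set_scope.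
Local Open Scope ring_scope.

Section Defs.
Context {R : realType}.

Definition Cb0 (f : R -> R) : Prop :=
  continuous f /\ (exists M : R, forall x, `|f x| <= M) /\ f 0 = 0.
Definition Lip0 (f : R -> R) : Prop :=
  (exists L : R, forall x y, `|f x - f y| <= L * `|x - y|) /\ f 0 = 0.

Definition sup_norm (f : R -> R) : \bar R :=
  ereal_sup [set (`|f x|)%:E | x in setT].
Definition lip_const (f : R -> R) : \bar R :=
  ereal_sup [set z | exists x y : R, x != y /\ z = (`|f x - f y| / `|x - y|)%:E].

Definition Kfun (lam : R) (f : R -> R) : \bar R :=
  ereal_inf [set z | exists f0 f1, Cb0 f0 /\ Lip0 f1 /\ f = f0 \+ f1 /\
     z = (sup_norm f0 + lam%:E * lip_const f1)%E].

Definition in_sum_space (f : R -> R) : Prop :=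
  exists f0 f1, Cb0 f0 /\ Lip0 f1 /\ f = f0 \+ f1.

Definition interp_space (theta : R) (q : \bar R) (f : R -> R) : Prop :=
  in_sum_space f /\
  match q with
  | +oo%E => exists C : R, forall lam : R, 0 < lam ->
             ((lam `^ (- theta))%:E * Kfun lam f <= C%:E)%E
  | r%:E => (\int[lebesgue_measure]_(lam in (`]0%R, +oo[%classic : set R))
               (((lam `^ (- theta) * fine (Kfun lam f)) `^ r) / lam)%:E < +oo)%E
  | -oo%E => False
  end.

Context {d : measure_display} {T : measurableType d}.

Definition aug_filtration (P : probability T R) (W : R -> T -> R) (t : R)
  : set (set T) :=
  <<s setT,
     [set A | exists s (B : set R), 0 <= s <= t /\ measurable B /\ A = W s @^-1` B]
     `|` [set N | exists N', measurable N' /\ P N' = 0%E /\ N `<=` N'] >>.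

Definition nat_filtration (W : R -> T -> R) (t : R) : set (set T) :=
  <<s setT, [set A | exists s (B : set R), 0 <= s <= t /\ measurable B /\
                         A = W s @^-1` B] >>.

Definition is_brownian (P : probability T R) (W : R -> T -> R) : Prop :=
  (forall t, 0 <= t <= 1 -> measurable_fun setT (W t)) /\
  (forall w, W 0 w = 0) /\
  (forall w, {within `[0, 1]%classic, continuous (fun t => W t w)}) /\
  (forall s t, 0 <= s -> s < t -> t <= 1 ->
     (forall B : set R, measurable B ->
        P ((fun w => (W t w - W s w)%R) @^-1` B) = normal_prob 0 (Num.sqrt (t - s)) B) /\
     (forall A (B : set R), nat_filtration W s A -> measurable B ->
        P (A `&` (fun w => (W t w - W s w)%R) @^-1` B) =
        (P A * P ((fun w => (W t w - W s w)%R) @^-1` B))%E)).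

Definition G_measurable (G : set (set T)) (Z : T -> \bar R) : Prop :=
  forall B : set (\bar R), measurable B -> G (Z @^-1` B).
Definition G_measurableR (G : set (set T)) (Z : T -> R) : Prop :=
  forall B : set R, measurable B -> G (Z @^-1` B).

Definition is_cond_exp_nonneg (P : probability T R) (G : set (set T))
  (X Z : T -> \bar R) : Prop :=
  (forall w, (0 <= Z w)%E) /\ G_measurable G Z /\
  forall A, G A -> (\int[P]_(w in A) Z w = \int[P]_(w in A) X w)%E.

Definition left_val (Y : R -> T -> R) (a : R) (w : T) : R :=
  if a == 0 then Y 0 w else lim ((fun t => Y t w) @ at_left a).

Definition bmo_sup (Y : R -> T -> R) (a : R) (w : T) : \bar R :=
  ereal_sup [set ((Y t w - left_val Y a w) ^+ 2)%:E | t in `[a, 1[%classic].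

Definition in_BMO2 (P : probability T R) (Fs : R -> set (set T))
  (Y : R -> T -> R) : Prop :=
  (forall t, 0 <= t < 1 -> G_measurableR (Fs t) (Y t)) /\
  (forall w t, 0 <= t < 1 ->
      (fun s => Y s w) @ at_right t --> Y t w) /\
  (forall w t, 0 < t < 1 -> cvg ((fun s => Y s w) @ at_left t)) /\
  (forall t, 0 <= t < 1 -> measurable_fun setT (Y t) /\
      (\int[P]_w ((Y t w) ^+ 2)%:E < +oo)%E) /\
  (exists c : R, forall a, 0 <= a < 1 -> exists Z : T -> \bar R,
      is_cond_exp_nonneg P (Fs a) (bmo_sup Y a) Z /\
      {ae P, forall w, (Z w <= c%:E)%E}).

Definition heatF (P : probability T R) (W : R -> T -> R) (f : R -> R)
  (t x : R) : R :=
  fine (\int[P]_w (f (x + W (1 - t) w))%:E)%E.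

Definition phi (P : probability T R) (W : R -> T -> R) (f : R -> R)
  (t : R) (w : T) : R :=
  derive1 (heatF P W f t) (W t w).

Definition frac_I (alpha : R) (ph : R -> T -> R) (t : R) (w : T) : R :=
  alpha * Rintegral lebesgue_measure `[0, 1]%classic
    (fun u => (1 - u) `^ (alpha - 1) * ph (Order.min u t) w).

End Defs.

(* Main.v *)
(** For a base b = B D with B = b^theta >= 4 and D = b^(1-theta) >= 4, take the
    lacunary series f(x) = sum_k c_k B^-k sin(b^k x) with c_k = (k+1)^(-1/2).
    Splitting the sum at n gives K(b^-n, f) <= 3 c_n B^-n, and (c_n) is in l^r for
    every r > 2, so f lies in the interpolation space; but (c_n) is not in l^2.
    Since E f(x + W_(1-t)) damps the k-th mode by exp(-b^(2k)(1-t)/2),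
      phi_t = sum_k c_k D^k exp(-b^(2k)(1-t)/2) cos(b^k W_t).
    The BMO condition at a = 0 alone would bound I_t^alpha phi in L_2 uniformly in
    t < 1. Test it against G = sum_(j<N) c_j cos(b^j W_1) at t = 1 - b^(-2N).
    All correlations E[cos(b^k W_u) cos(b^j W_1)] are nonnegative, so dropping the
    off-diagonal ones gives E[G I_t^alpha phi] >= kappa S_N with
    S_N = sum_(j<N) c_j^2, while E[G^2] <= S_N + 16 by lacunarity. Hence S_N would
    be bounded, contradicting the divergence of the harmonic series. *)
Require Import Defs.
From HB Require Import structures.
From mathcomp Require Import all_boot all_order all_algebra.
From mathcomp Require Import all_classical all_reals all_analysis.
From mathcomp Require Import measurable_realfun ring lra.
Set Implicit Arguments. Unset Strict Implicit. Unset Printing Implicit Defensive.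
Import Order.TTheory GRing.Theory Num.Theory.
Import numFieldNormedType.Exports.
Local Open Scope classical_set_scope.
Local Open Scope ring_scope.

(** * Geometrically dominated series *)

Section GeometricDomination.
Context {R : realType}.
Implicit Types (C M x h : R) (g u v : nat -> R) (n k : nat).

(** The choice [alpha = (1 - theta) / 2] makes mode j scale-invariant: with gap_j = b^(-2j) one has
    gap_j^alpha = D^(-j). On the last stretch [1 - gap_j, 1) the damping of mode j, coming once from
    phi and once from conditioning G, stays above e^(-1), while the kernel (1-u)^(alpha-1) has there
    at least the mass gap_j^alpha. That mass cancels the growth D^j, so each mode contributes c_j^2
    up to a constant. Stopping at t = 1 - gap_N leaves the stretches of all modes j < N effective,
    since phi frozen at t is damped no more than phi at time 1 - gap_j.

    Duality with G replaces the square of the fractional integral: only one time integral occurs,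
    and the signs of the correlations do the rest.

    Both B >= 4 and D >= 4 are wanted because two opposite sums must be controlled by one term each:
    the sup-norm of a tail by its first term (decay of B^(-k)) and the Lipschitz constant of a head
    by its top term (growth of D^k). The weights c_k vary slowly enough, by at most a factor 2 per
    step, not to disturb either. *)

Lemma quarter_ge0 k : 0 <= (4^-1 : R) ^+ k.
Proof. by rewrite exprn_ge0// invr_ge0. Qed.

Lemma sum_quarter_lt n m : \sum_(n <= k < m) (4^-1 : R) ^+ k <= 2 * 4^-1 ^+ n.
Proof.
have [mn|/ltnW nm] := leqP m n.
  by rewrite big_geq// mulr_ge0// quarter_ge0.
(* The subtracted term lets the induction close; the exact factor 4/3 of the geometric sum is
   rounded up to 2. *)
suff : \sum_(n <= k < m) (4^-1 : R) ^+ k <= 2 * 4^-1 ^+ n - 2 * 4^-1 ^+ m.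
  by move/le_trans; apply; rewrite gerBl mulr_ge0// quarter_ge0.
rewrite -(subnKC nm); elim: (m - n)%N => [|j IH].
  by rewrite addn0 big_geq// subrr.
rewrite addnS big_nat_recr ?leq_addr//= exprS.
have := quarter_ge0 (n + j); lra.
Qed.

(** The ratio 1/4 is fixed once and for all, matching the lower bound 4 on [B]. The series for f,
    for its gradient and for their expectations then differ only in the constant [C]. *)
Lemma geom_dom_cvg C g : (forall k, `|g k| <= C * 4^-1 ^+ k) -> cvgn (series g).
Proof.
move=> gC; apply: normed_cvg.
apply: (@series_le_cvg _ _ (geometric C 4^-1)) => //=.
- by move=> n; exact: le_trans (normr_ge0 _) (gC n).
- by apply: is_cvg_geometric_series; rewrite ger0_norm ?invr_ge0// invf_lt1 ?ltr1n.
Qed.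

Lemma geom_dom_tail C g n : (forall k, (n <= k)%N -> `|g k| <= C * 4^-1 ^+ k) ->
  cvgn (series g) -> `|limn (series g) - series g n| <= 2 * C * 4^-1 ^+ n.
Proof.
move=> gC cg.
have C0 : 0 <= C.
  have := le_trans (normr_ge0 _) (gC n (leqnn n)).
  by rewrite pmulr_lge0// exprn_gt0// invr_gt0.
have cv : `|series g m - series g n| @[m --> \oo] -->
    `|limn (series g) - series g n|.
  by apply: cvg_norm; apply: cvgB => //; exact: cvg_cst.
rewrite -(cvg_lim _ cv)//; apply: limr_le; first by apply/cvg_ex; eexists; exact: cv.
near=> m.
have nm : (n <= m)%N by near: m; exact: nbhs_infty_ge.
rewrite sub_series_geq//; apply: le_trans (ler_norm_sum _ _ _) _.
apply: (@le_trans _ _ (\sum_(n <= k < m) C * 4^-1 ^+ k)).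
  by rewrite big_nat_cond [leRHS]big_nat_cond; apply: ler_sum => k /andP[/andP[/gC]].
by rewrite -mulr_sumr (mulrC 2) -mulrA ler_wpM2l// sum_quarter_lt.
Unshelve. all: by end_near. Qed.

Lemma geom_dom_lim C g : (forall k, `|g k| <= C * 4^-1 ^+ k) ->
  `|limn (series g)| <= 2 * C.
Proof.
move=> gC; have := @geom_dom_tail C g 0%N (fun k _ => gC k) (geom_dom_cvg gC).
by rewrite /series/= big_geq// subr0 expr0 mulr1.
Qed.

Lemma sin_diff_le x h : `|sin (x + h) - sin x| <= `|h|.
Proof.
have H (y z : R) : y < z -> `|sin z - sin y| <= `|z - y|.
  move=> yz; have [c _ ->] := @MVT R sin cos y z yz (fun t _ => is_derive_sin t)
    (continuous_subspaceT (@continuous_sin R)).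
  by rewrite normrM ler_piMl// ler_norml cos_geN1 cos_le1.
have [h0|h0|->] := ltgtP h 0.
- have /H : x + h < x by rewrite gtrDl.
  by rewrite distrC opprD addNKr normrN.
- have /H : x < x + h by rewrite ltrDl.
  by rewrite (addrC x h) addrK.
- by rewrite addr0 subrr normr0.
Qed.

Lemma cos_diff_le x h : `|cos (x + h) - cos x| <= `|h|.
Proof.
have H (y z : R) : y < z -> `|cos z - cos y| <= `|z - y|.
  move=> yz; have [c _ ->] := @MVT R cos (fun x => - sin x) y z yz (fun t _ => is_derive_cos t)
    (continuous_subspaceT (@continuous_cos R)).
  by rewrite normrM normrN ler_piMl// ler_norml sin_geN1 sin_le1.
have [h0|h0|->] := ltgtP h 0.
- have /H : x + h < x by rewrite gtrDl.
  by rewrite distrC opprD addNKr normrN.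
- have /H : x < x + h by rewrite ltrDl.
  by rewrite (addrC x h) addrK.
- by rewrite addr0 subrr normr0.
Qed.

Lemma sin_taylor_le x h : `|sin (x + h) - sin x - h * cos x| <= h ^+ 2.
Proof.
(* The base point [w] may be either endpoint, so that both signs of [h] are covered. Two uses of the
   mean value theorem give the constant 1, which is enough here. *)
have H (y z w : R) : y < z -> (w = y \/ w = z) ->
    `|sin z - sin y - (z - y) * cos w| <= (z - y) ^+ 2.
  move=> yz wyz; have [c + ->] := @MVT R sin cos y z yz (fun t _ => is_derive_sin t)
    (continuous_subspaceT (@continuous_sin R)).
  rewrite in_itv/= => /andP[yc cz].
  rewrite mulrC -mulrBr normrM expr2 (@gtr0_norm _ (z - y)) ?subr_gt0//.
  rewrite ler_wpM2l ?subr_ge0 ?(ltW yz)//.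
  have := cos_diff_le w (c - w); rewrite subrKC => /le_trans; apply.
  by case: wyz => ->; rewrite ler_norml; apply/andP; split; lra.
have [h0|h0|->] := ltgtP h 0.
- have /H/(_ (or_intror erefl)) : x + h < x by rewrite gtrDl.
  rewrite opprD addNKr sqrrN mulNr opprK => le; apply: le_trans le.
  by rewrite -normrN le_eqVlt; apply/orP; left; apply/eqP; congr `|_|; ring.
- have /H/(_ (or_introl erefl)) : x < x + h by rewrite ltrDl.
  by rewrite (addrC x h) addrK.
- by rewrite addr0 subrr mul0r subrr normr0 expr0n.
Qed.

(** The Taylor remainder of the k-th term, divided by h, is at most |A_k| b_k^2 |h|. Summing the
    dominating series bounds the error of the difference quotient by 2C|h|, so no theorem on uniform
    convergence of derivatives is called for. *)
Lemma is_derive_sin_series C (A b : nat -> R) x :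
  (forall k, 1 <= b k) -> (forall k, `|A k| * b k ^+ 2 <= C * 4^-1 ^+ k) ->
  is_derive x (1 : R) (fun x => limn (series (fun k => A k * sin (b k * x))))
    (limn (series (fun k => A k * b k * cos (b k * x)))).
Proof.
move=> b1 AC.
have b0 k : 0 <= b k := le_trans ler01 (b1 k).
have Ab k : `|A k| * b k <= C * 4^-1 ^+ k.
  apply: le_trans (AC k); rewrite ler_wpM2l//.
  by rewrite expr2 ler_peMr.
have A0 k : `|A k| <= C * 4^-1 ^+ k.
  by apply: le_trans (Ab k); rewrite ler_peMr.
have cS y : cvgn (series (fun k => A k * sin (b k * y))).
  apply: (@geom_dom_cvg C) => k; apply: le_trans (A0 k).
  by rewrite normrM ler_piMr// ler_norml sin_geN1 sin_le1.
have cC : cvgn (series (fun k => A k * b k * cos (b k * x))).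
  apply: (@geom_dom_cvg C) => k; apply: le_trans (Ab k).
  rewrite !normrM (ger0_norm (b0 k)) ler_piMr ?mulr_ge0//.
  by rewrite ler_norml cos_geN1 cos_le1.
have rem h : h != 0 -> `|h^-1 * (limn (series (fun k => A k * sin (b k * (h + x))))
      - limn (series (fun k => A k * sin (b k * x))))
    - limn (series (fun k => A k * b k * cos (b k * x)))| <= 2 * (C * `|h|).
  move=> h0.
  pose u k := A k * sin (b k * (h + x)).
  pose v k := A k * sin (b k * x).
  pose w k := A k * b k * cos (b k * x).
  have -> : h^-1 * (limn (series u) - limn (series v)) - limn (series w) =
      limn (series (h^-1 *: (u - v) - w)).
    rewrite lim_seriesB; [|apply: is_cvg_seriesZ; apply: is_cvg_seriesB; exact: cS|exact: cC].
    rewrite lim_seriesZ; last by apply: is_cvg_seriesB; exact: cS.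
    by rewrite lim_seriesB//; exact: cS.
  apply: geom_dom_lim => k.
  rewrite /u /v /w !fctE.
  have -> : h^-1 *: (A k * sin (b k * (h + x)) - A k * sin (b k * x)) -
      A k * b k * cos (b k * x) =
      A k * (h^-1 * (sin (b k * x + b k * h) - sin (b k * x) - b k * h * cos (b k * x))).
    by rewrite mulrDr (addrC (b k * h)) /GRing.scale/=; field.
  rewrite normrM normrM normfV.
  apply: (@le_trans _ _ (`|A k| * (`|h|^-1 * (b k * h) ^+ 2))).
    by rewrite !ler_wpM2l ?invr_ge0// sin_taylor_le.
  have -> : `|h|^-1 * (b k * h) ^+ 2 = b k ^+ 2 * `|h|.
    rewrite exprMn -(real_normK (num_real h)); have : `|h| != 0 by rewrite normr_eq0.
    by move=> ?; field.
  by rewrite mulrA [leRHS]mulrAC ler_wpM2r.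
have C0 : 0 <= C.
  by have := le_trans (mulr_ge0 (normr_ge0 _) (b0 0%N)) (Ab 0%N); rewrite mulr1.
have D : h^-1 *: ((limn (series (fun k => A k * sin (b k * (h *: (1:R) + x)))))
      - limn (series (fun k => A k * sin (b k * x)))) @[h --> 0^'] -->
      limn (series (fun k => A k * b k * cos (b k * x))).
  apply/cvgrPdist_le => e e0.
  near=> h.
  rewrite distrC.
  have -> : h *: (1 : R) = h by rewrite /GRing.scale/= mulr1.
  have h0 : h != 0 by near: h; exact: nbhs_dnbhs_neq.
  apply: (le_trans (rem h h0)).
  have : `|h| <= e / (2 * (C + 1)).
    near: h; apply: dnbhs0_le; rewrite divr_gt0// mulr_gt0//; lra.
  move=> hh; apply: (@le_trans _ _ (2 * ((C + 1) * `|h|))).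
    by rewrite ler_wpM2l// ler_wpM2r//; lra.
  by rewrite mulrA mulrC -ler_pdivlMr// mulr_gt0//; lra.
apply: DeriveDef.
  by apply/cvg_ex; eexists; exact: D.
by apply/cvg_lim => //; exact: D.
Unshelve. all: by end_near. Qed.

End GeometricDomination.

(** * Fourier transform of the centred Gaussian law *)

Section Gaussian.
Context {R : realType}.
Local Notation leb := (@lebesgue_measure R).
Implicit Types (s x : R) (f g F : R -> R).

Lemma integral_normal_prob s g : s != 0 -> measurable_fun setT g ->
  (normal_prob 0 s).-integrable setT (EFin \o g) ->
  (\int[normal_prob 0 s]_x (g x)%:E = \int[leb]_x (g x * normal_pdf 0 s x)%:E)%E.
Proof.
move=> s0 mg ig.
have dom := normal_prob_dominates 0 s.
rewrite -(Radon_Nikodym_change_of_variables dom)//=.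
apply: ae_eq_integral => //.
- apply: emeasurable_funM; first exact/measurable_EFinP.
  apply: (measurable_int leb).
  by apply: Radon_Nikodym_integrable; exact: dom.
- apply/measurable_EFinP/measurable_funM => //; exact: measurable_normal_pdf.
- under [X in ae_eq _ _ _ X]eq_fun do rewrite EFinM.
  apply: ae_eqe_mul2l => /=.
  rewrite Radon_NikodymE//=.
  case: cid => /= h [h1 h2 h3].
  apply: integral_ae_eq => //=.
  + by apply/measurable_EFinP; exact: measurable_normal_pdf.
  + by move=> E _ mE; rewrite -h3.
Qed.

(** The fundamental theorem of calculus on growing symmetric intervals, followed by dominated
    convergence with |f| as majorant. The index [n.+1] keeps the intervals nondegenerate. *)
Lemma integral_derivative_eq0 f F : (forall x, is_derive x (1 : R) F (f x)) ->
  continuous f -> leb.-integrable setT (EFin \o f) ->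
  F n%:R @[n --> \oo] --> (0 : R) -> F (- n%:R) @[n --> \oo] --> (0 : R) ->
  \int[leb]_x f x = 0.
Proof.
move=> dF cf fi Fp Fm.
pose In n := `[- n%:R, n%:R]%classic : set R.
have mf : measurable_fun setT f by exact: continuous_measurable_fun.
have E n : (\int[leb]_(x in In n.+1) (f x)%:E = (F n.+1%:R - F (- n.+1%:R))%:E)%E.
  rewrite /In EFinB; apply: continuous_FTC2.
  - by rewrite (@lt_trans _ _ 0)// ?oppr_lt0 ltr0Sn.
  - exact: continuous_subspaceT.
  - split.
    + by move=> x _; exact: ex_derive.
    + apply: cvg_at_right_filter; apply: differentiable_continuous.
      by apply/derivable1_diffP; exact: ex_derive.
    + apply: cvg_at_left_filter; apply: differentiable_continuous.
      by apply/derivable1_diffP; exact: ex_derive.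
  - by move=> x _; rewrite derive1E; exact: derive_val.
have [||||| _ _ /= cv] := @dominated_convergence _ _ R leb setT measurableT
  (fun n x => ((f \_ (In n.+1)) x)%:E) (EFin \o f) (fun x => (`|f x|)%:E).
  - move=> n; apply/measurable_EFinP; apply/(measurable_restrictT _ (measurable_itv _)).
    exact: measurable_funTS.
  - exact/measurable_EFinP.
  - apply: aeW => x _; apply: cvg_near_cst; near=> n.
    congr EFin; rewrite patchE mem_set// /In/= in_itv/= -ler_norml.
    have tn : (Num.truncn `|x| < n.+1)%N by near: n; exists (Num.truncn `|x|).
    by rewrite (le_trans (ltW (truncnS_gt _)))// ler_nat.
  - have := integrable_norm fi; apply: eq_integrable => //.
  - apply: aeW => x n _; rewrite lee_fin patchE; case: ifPn => // _.
    by rewrite normr0.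
have E2 n : (\int[leb]_x ((f \_ (In n.+1)) x)%:E = (F n.+1%:R - F (- n.+1%:R))%:E)%E.
  by rewrite -E [RHS]integral_mkcond; apply: eq_integral => x _; rewrite restrict_EFin.
have cv2 : (F n.+1%:R - F (- n.+1%:R))%:E @[n --> \oo] --> (0 - 0 : R)%:E.
  apply: cvg_EFin; first exact: nearW.
  apply: cvgB; by [move: Fp; rewrite -cvg_shiftS|move: Fm; rewrite -cvg_shiftS].
rewrite /Rintegral.
have -> : (\int[leb]_x (f x)%:E = (0 - 0 : R)%:E)%E; last by rewrite subrr.
apply: cvg_unique cv2 => //=.
by under eq_fun do rewrite -E2.
Unshelve. all: by end_near. Qed.

End Gaussian.

Section GaussianTransform.
Context {R : realType}.
Local Notation leb := (@lebesgue_measure R).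
Implicit Types (s t x : R) (u v : R -> R).

(** Half of the Gaussian exponent is spent on absorbing |x|, through 1 + y <= e^y with y = x^2 / (4
    s^2). The other half remains: it is a multiple of the density with standard deviation s * sqrt
    2, which serves as an integrable majorant. *)
Lemma normal_pdf_moment_bound s x : s != 0 ->
  `|x| * normal_pdf 0 s x <= (1 + 4 * s ^+ 2) * normal_peak s
     * expR (- x ^+ 2 / (4 * s ^+ 2)).
Proof.
move=> s0; rewrite normal_pdfE// /normal_fun subr0.
have s2 : 0 < s ^+ 2 by rewrite exprn_even_gt0.
set y := x ^+ 2 / (4 * s ^+ 2).
have y0 : 0 <= y by rewrite divr_ge0 ?sqr_ge0// mulr_ge0// ltW.
have -> : - x ^+ 2 / (s ^+ 2 *+ 2) = - y + - y by rewrite /y; field.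
have -> : - x ^+ 2 / (4 * s ^+ 2) = - y by rewrite mulNr.
suff H : `|x| * expR (- y) <= 1 + 4 * s ^+ 2.
  rewrite expRD; have := ler_wpM2r (mulr_ge0 (normal_peak_ge0 s) (expR_ge0 (- y))) H.
  by rewrite !mulrA (mulrAC _ (expR _) (normal_peak s)).
rewrite expRN ler_pdivrMr ?expR_gt0//.
apply: (@le_trans _ _ ((1 + 4 * s ^+ 2) * (1 + y))); last first.
  by rewrite ler_wpM2l ?expR_ge1Dx// addr_ge0// mulr_ge0// ltW.
have -> : (1 + 4 * s ^+ 2) * (1 + y) = 1 + 4 * s ^+ 2 + y + x ^+ 2.
  by rewrite /y; field.
have := sqr_ge0 (`|x| - 1); rewrite sqrrB1 real_normK ?num_real//.
have := normr_ge0 x; nra.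
Qed.

Lemma normal_pdf_moment_integrable s : s != 0 ->
  leb.-integrable setT (fun x => (`|x| * normal_pdf 0 s x)%:E).
Proof.
move=> s0.
have q0 : s * Num.sqrt 2 != 0 by rewrite mulf_neq0// gt_eqF// sqrtr_gt0.
pose K := (1 + 4 * s ^+ 2) * normal_peak s / normal_peak (s * Num.sqrt 2).
apply: (@le_integrable _ _ _ leb setT measurableT _
  (fun x => (K * normal_pdf 0 (s * Num.sqrt 2) x)%:E)).
- apply/measurable_EFinP/measurable_funM; last exact: measurable_normal_pdf.
  exact: normr_measurable.
- move=> x _; rewrite lee_fin ger0_norm ?mulr_ge0 ?normal_pdf_ge0//.
  apply: le_trans (ler_norm _); apply: le_trans (normal_pdf_moment_bound _ s0) _.
  rewrite normal_pdfE// /normal_fun subr0 exprMn sqr_sqrtr//.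
  have : normal_peak (s * Num.sqrt 2) != 0 by rewrite gt_eqF// normal_peak_gt0.
  rewrite /K; set p := normal_peak (s * _) => p0; set A := _ * normal_peak s.
  set e := expR (- (_ ^+ 2) / (_ *+ 2)); have -> : A / p * (p * e) = A * e by field.
  rewrite /e.
  by rewrite le_eqVlt; apply/orP; left; apply/eqP; congr (_ * expR (_ / _)); ring.
- under eq_fun do rewrite EFinM.
  by apply: integrableZl => //; exact: integrable_normal_pdf.
Qed.

Lemma is_derive_normal_pdf s x : s != 0 ->
  is_derive x (1 : R) (normal_pdf 0 s) (- (x / s ^+ 2) * normal_pdf 0 s x).
Proof.
move=> s0; rewrite normal_pdfE//.
have -> : (fun x => normal_peak s * normal_fun 0 s x) =
    normal_peak s \*: (expR \o (fun x => (- (s ^+ 2 *+ 2)^-1) *: (x ^+ 2 : R))).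
  apply/funext => z; rewrite /= /normal_fun subr0 /GRing.scale/=.
  by congr (_ * expR _); ring.
apply: is_derive_eq.
rewrite /GRing.scale/= /normal_fun subr0.
have -> : - (s ^+ 2 *+ 2)^-1 * x ^+ 2 = - x ^+ 2 / (s ^+ 2 *+ 2) by ring.
by field.
Qed.

Lemma normal_pdf_cvg0 s : s != 0 -> normal_pdf 0 s n%:R @[n --> \oo] --> (0 : R).
Proof.
move=> s0; rewrite -cvg_shiftS.
pose M := (1 + 4 * s ^+ 2) * normal_peak s.
have M0 : 0 <= M.
  by rewrite mulr_ge0 ?normal_peak_ge0// addr_ge0// mulr_ge0// sqr_ge0.
apply: (@squeeze_cvgr _ _ _ _ (cst 0) (fun n => M * n.+1%:R^-1)).
- near=> n; rewrite normal_pdf_ge0/= ler_pdivlMr// mulrC.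
  have := normal_pdf_moment_bound n.+1%:R s0; rewrite ger0_norm// => /le_trans; apply.
  rewrite ler_piMr ?M0//.
  by rewrite expR_le1 mulNr oppr_le0 divr_ge0// ?sqr_ge0// mulr_ge0// sqr_ge0.
- exact: cvg_cst.
- by rewrite -[X in _ --> X](mulr0 M); apply: cvgMl_tmp; exact: cvg_harmonic.
Unshelve. all: by end_near. Qed.

Lemma normal_pdf_even s x : s != 0 -> normal_pdf 0 s (- x) = normal_pdf 0 s x.
Proof. by move=> s0; rewrite normal_pdfE// /normal_fun !subr0 sqrrN. Qed.

Lemma bounded_normal_integrable s u : measurable_fun setT u ->
  (forall x, `|u x| <= 1) ->
  leb.-integrable setT (fun x => (u x * normal_pdf 0 s x)%:E).
Proof.
move=> mu u1; apply: (@le_integrable _ _ _ leb setT measurableT _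
  (fun x => (normal_pdf 0 s x)%:E)).
- apply/measurable_EFinP/measurable_funM => //; exact: measurable_normal_pdf.
- move=> x _; rewrite lee_fin normrM ler_piMl//.
- exact: integrable_normal_pdf.
Qed.

End GaussianTransform.

Section GaussianTrigonometry.
Context {R : realType}.
Local Notation leb := (@lebesgue_measure R).

Lemma is_derive_scaled (u v : R -> R) (c x : R) :
  (forall x, is_derive x (1 : R) u (v x)) ->
  is_derive x (1 : R) (fun x : R => u (c * x)) (c * v (c * x)).
Proof.
move=> du.
have h1 : is_derive x (1 : R) (c \*: (id : R -> R)) c.
  by apply: is_derive_eq; rewrite /GRing.scale/= mulr1.
have := is_derive1_comp (du (c * x)) h1.
by rewrite mulrC.
Qed.

(* [u'] = [v] and [v'] = [-u] covers both cos and sin; integration by parts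
   turns the Gaussian transform h of u into a solution of h' = - s^2 t h. *)
Lemma normal_trig_transform (u v : R -> R) (s t : R) : s != 0 ->
  (forall x, is_derive x (1 : R) u (v x)) ->
  (forall x, is_derive x (1 : R) v (- u x)) ->
  (forall x, `|u x| <= 1) -> (forall x, `|v x| <= 1) ->
  \int[leb]_x (u (t * x) * normal_pdf 0 s x) = u 0 * expR (- (s ^+ 2 * t ^+ 2 / 2)).
Proof.
move=> s0 du dv u1 v1.
have cu : continuous u.
  move=> x; apply: differentiable_continuous.
  by apply/derivable1_diffP; exact: ex_derive.
have cv : continuous v.
  move=> x; apply: differentiable_continuous.
  by apply/derivable1_diffP; exact: ex_derive.
have cscale (w : R -> R) (c : R) : continuous w -> continuous (fun x : R => w (c * x)).
  move=> cw x; apply: (@continuous_comp _ _ _ (fun x : R => c * x) w); last exact: cw.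
  by apply: cvgM; [exact: cvg_cst|exact: cvg_id].
have mscale (w : R -> R) (c : R) : continuous w ->
    measurable_fun setT (fun x : R => w (c * x)).
  by move=> cw; apply: continuous_measurable_fun; exact: cscale.
pose p := normal_pdf (0 : R) s.
pose h t := \int[leb]_x (u (t * x) * p x).
have mxvp (c : R) : measurable_fun setT (fun x : R => x * v (c * x) * p x).
  apply: measurable_funM; last exact: measurable_normal_pdf.
  by apply: measurable_funM => //; exact: mscale.
have ixvp (c : R) : leb.-integrable setT (fun x : R => (x * v (c * x) * p x)%:E).
  apply: (@le_integrable _ _ _ leb setT measurableT _
      (fun x : R => (`|x| * normal_pdf 0 s x)%:E)) => //.
  - by apply/measurable_EFinP; exact: mxvp.
  - move=> x _; rewrite lee_fin !normrM normr_id ler_wpM2r//.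
    by rewrite ler_piMr.
  - exact: normal_pdf_moment_integrable.
have iup (c : R) : leb.-integrable setT (fun x : R => (u (c * x) * p x)%:E).
  by apply: bounded_normal_integrable => //; exact: mscale.
(* Integration by parts in the form: [f] is the derivative of [F], and [F] vanishes at both
   infinities because the density does, so [f] has integral 0. *)
have parts (c : R) : \int[leb]_x (x * v (c * x) * p x) = - (s ^+ 2 * c) * h c.
  pose F (x : R) := v (c * x) * p x.
  pose f (x : R) := - c * (u (c * x) * p x) + (- (s ^+ 2)^-1) * (x * v (c * x) * p x).
  have i1 : leb.-integrable setT (EFin \o (fun x : R => - c * (u (c * x) * p x))).
    by rewrite /comp; under eq_fun do rewrite EFinM; exact: integrableZl.
  have i2 : leb.-integrable setT
      (EFin \o (fun x : R => - (s ^+ 2)^-1 * (x * v (c * x) * p x))).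
    by rewrite /comp; under eq_fun do rewrite EFinM; exact: integrableZl.
  have : \int[leb]_x f x = 0.
    apply: (@integral_derivative_eq0 _ f F).
    - move=> x; have := is_deriveM (is_derive_scaled c x dv) (is_derive_normal_pdf x s0).
      move/is_derive_eq; apply; rewrite /f /GRing.scale/= -/p; field.
      by [].
    - move=> x; apply: cvgD.
        apply: cvgM; first exact: cvg_cst.
        apply: cvgM; first exact: (cscale _ _ cu).
        exact: continuous_normal_pdf.
      apply: cvgM; first exact: cvg_cst.
      apply: cvgM; last exact: continuous_normal_pdf.
      by apply: cvgM; [exact: cvg_id|exact: (cscale _ _ cv)].
    - rewrite /f /comp; under eq_fun do rewrite EFinD.
      exact: integrableD.
    - apply: norm_cvg0; apply: (squeeze_cvgr _ (cvg_cst 0) (normal_pdf_cvg0 s0)).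
      apply: nearW => n; rewrite normr_ge0/= normrM.
      by rewrite (ger0_norm (normal_pdf_ge0 _ _ _)) ler_piMl// normal_pdf_ge0.
    - apply: norm_cvg0; apply: (squeeze_cvgr _ (cvg_cst 0) (normal_pdf_cvg0 s0)).
      apply: nearW => n; rewrite normr_ge0/= normrM /p normal_pdf_even//.
      by rewrite (ger0_norm (normal_pdf_ge0 _ _ _)) ler_piMl// normal_pdf_ge0.
  rewrite /f (RintegralD measurableT i1 i2).
  rewrite (RintegralZl _ measurableT (iup c)) (RintegralZl _ measurableT (ixvp c)) -/(h c).
  set J := \int[leb]_x (_ * _ * _) => /eqP; rewrite addrC addr_eq0 => /eqP E.
  have -> : J = - (s ^+ 2) * (- (s ^+ 2)^-1 * J) by field.
  by rewrite E; ring.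
have dh (c : R) : is_derive c (1 : R) h (- (s ^+ 2 * c) * h c).
  (* Any neighbourhood of [c] would do: the majorant |y| p(y) of the parameter derivative does not
     depend on the parameter. *)
  have cI : `]c - 1, c + 1[%classic c.
    by rewrite /= in_itv/=; apply/andP; split; lra.
  have d1 (x y : R) : is_derive x (1 : R) (fun x : R => u (x * y) * p y) (y * v (x * y) * p y).
    have H := is_derive_scaled y x du.
    have H2 : is_derive x (1 : R) (p y \*: (fun z => u (y * z))) (p y *: (y * v (y * x))).
      by apply: is_deriveZ; exact: H.
    have -> : (fun x : R => u (x * y) * p y) = p y \*: (fun z => u (y * z)).
      by apply/funext => z; rewrite /= /GRing.scale/= mulrC (mulrC z).
    by apply: is_derive_eq; rewrite /GRing.scale/= mulrC (mulrC y x).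
  have a1 (x : R) : `]c - 1, c + 1[%classic x ->
    leb.-integrable setT (EFin \o (fun y : R => u (x * y) * p y)) by move=> _; exact: iup.
  have a2 (x y : R) : `]c - 1, c + 1[%classic x -> setT y ->
      derivable (fun x : R => u (x * y) * p y) x 1.
    by move=> _ _; case: (d1 x y).
  have a3 (y : R) : 0 <= `|y| * normal_pdf 0 s y by rewrite mulr_ge0// normal_pdf_ge0.
  have p1E (x y : R) : partial1of2 (fun x y : R => u (x * y) * p y) x y = y * v (x * y) * p y.
    by rewrite /partial1of2 derive1E; case: (d1 x y).
  have a4 (x y : R) : `]c - 1, c + 1[%classic x -> setT y ->
      `|partial1of2 (fun x y : R => u (x * y) * p y) x y| <= `|y| * normal_pdf 0 s y.
    move=> _ _; rewrite p1E !normrM (ger0_norm (normal_pdf_ge0 _ _ _)).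
    by rewrite ler_wpM2r ?normal_pdf_ge0// ler_piMr.
  have im := normal_pdf_moment_integrable s0.
  apply: DeriveDef.
    exact: (derivable_under_integral measurableT cI a1 a2 a3 im a4).
  rewrite -derive1E.
  rewrite (differentiation_under_integral measurableT cI a1 a2 a3 im a4).
  by rewrite -parts; apply: eq_Rintegral => x _; rewrite p1E.
(* Integrating factor of the equation h' = - s^2 c h: the product [h * e] has zero derivative, hence
   equals its value at 0. *)
pose e (c : R) := expR (s ^+ 2 / 2 * c ^+ 2).
have de (c : R) : is_derive c (1 : R) e (s ^+ 2 * c * e c).
  have -> : e = expR \o ((s ^+ 2 / 2) \*: (fun c : R => c ^+ 2)) by [].
  by apply: is_derive_eq; rewrite /GRing.scale/=; field.
have cst : h t * e t = h 0 * e 0.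
  apply: (@is_derive_0_is_cst _ (h * e)) => c.
  have := is_deriveM (dh c) (de c) => /is_derive_eq; apply.
  by rewrite /GRing.scale/=; ring.
have h0 : h 0 = u 0.
  rewrite /h; under eq_Rintegral do rewrite mul0r.
  rewrite RintegralZl//; last exact: integrable_normal_pdf.
  by rewrite /Rintegral integral_normal_pdf/= mulr1.
have e0 : e 0 = 1 by rewrite /e expr0n/= mulr0 expR0.
rewrite -/(h t) -h0; move: cst; rewrite e0 mulr1 => <-.
rewrite -(mulrA (h t)) /e -expRD [X in expR X](_ : _ = 0) ?expR0 ?mulr1//.
by ring.
Qed.

Lemma normal_cos_transform (s t : R) : s != 0 ->
  \int[leb]_x (cos (t * x) * normal_pdf 0 s x) = expR (- (s ^+ 2 * t ^+ 2 / 2)).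
Proof.
move=> s0; rewrite (@normal_trig_transform cos (fun x : R => - sin x))//.
- by rewrite cos0 mul1r.
- by move=> x; rewrite ler_norml cos_geN1 cos_le1.
- by move=> x; rewrite normrN ler_norml sin_geN1 sin_le1.
Qed.

Lemma normal_sin_transform (s t : R) : s != 0 ->
  \int[leb]_x (sin (t * x) * normal_pdf 0 s x) = 0.
Proof.
move=> s0; rewrite (@normal_trig_transform sin cos)//.
- by rewrite sin0 mul0r.
- by move=> x; rewrite ler_norml sin_geN1 sin_le1.
- by move=> x; rewrite ler_norml cos_geN1 cos_le1.
Qed.

End GaussianTrigonometry.

(** * Expectations of bounded variables *)

Section BoundedExpectation.
Context {R : realType} {d : measure_display} {T : measurableType d}.
Variable P : probability T R.
Implicit Types (X Y : T -> R).

Lemma bounded_expectation_integrable X (M : R) :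
  measurable_fun setT X -> (forall w, `|X w| <= M) -> P.-integrable setT (EFin \o X).
Proof.
move=> mX XM; apply: measurable_bounded_integrable => //.
- by rewrite (le_lt_trans (probability_le1 P measurableT))// ltry.
- by exists M; split => [|x Mx w _]; [exact: num_real|exact: le_trans (XM w) (ltW Mx)].
Qed.

Lemma expectation_series (X : nat -> T -> R) (C : R) :
  (forall k, measurable_fun setT (X k)) ->
  (forall k w, `|X k w| <= C * 4^-1 ^+ k) ->
  \int[P]_w limn (series (X ^~ w)) = limn (series (fun k => \int[P]_w X k w)).
Proof.
move=> mX XC.
have mS n : measurable_fun setT (fun w => series (X ^~ w) n).
  by apply: measurable_sum => k; exact: mX.
have cX w : cvgn (series (X ^~ w)) by apply: (@geom_dom_cvg _ C) => k; exact: XC.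
have C0 : 0 <= C.
  by rewrite -[C]mulr1 -(expr0 4^-1); apply: le_trans (XC 0%N point).
have S2C n w : `|series (X ^~ w) n| <= 2 * C.
  apply: le_trans (ler_norm_sum _ _ _) _.
  apply: (@le_trans _ _ (\sum_(0 <= k < n) C * 4^-1 ^+ k)).
    by apply: ler_sum => k _; exact: XC.
  by rewrite -mulr_sumr mulrC ler_wpM2r//; have := @sum_quarter_lt R 0 n; rewrite expr0 mulr1.
have [||||| iL _ /= cv] := @dominated_convergence _ _ R P setT measurableT
  (fun n w => (series (X ^~ w) n)%:E) (fun w => (limn (series (X ^~ w)))%:E)
  (fun w => (2 * C)%:E).
- by move=> n; exact/measurable_EFinP.
- by apply/measurable_EFinP; apply: (measurable_fun_cvg mS) => w _; exact: cX.
- by apply: aeW => w _; apply: cvg_EFin; [exact: nearW|exact: cX].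
- by apply: (@bounded_expectation_integrable (cst (2 * C)) `|2 * C|).
- by apply: aeW => w n _; rewrite lee_fin.
have iS n : P.-integrable setT (EFin \o (fun w => series (X ^~ w) n)).
  exact: bounded_expectation_integrable.
have iX k : P.-integrable setT (EFin \o X k).
  by apply: bounded_expectation_integrable => // w; exact: XC.
have E n : \int[P]_w series (X ^~ w) n = series (fun k => \int[P]_w X k w) n.
  elim: n => [|n IH].
    under eq_Rintegral do rewrite /series/= big_geq//.
    by rewrite /series/= big_geq// Rintegral_cst//= mul0r.
  under eq_Rintegral do rewrite seriesS.
  by rewrite seriesS RintegralD// IH.
apply/esym/cvg_lim => //.
have -> : series (fun k => \int[P]_w X k w) = fun n => \int[P]_w series (X ^~ w) n.
  by apply/funext => n; rewrite E.
by apply: fine_cvg; rewrite fineK//; exact: integrable_fin_num.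
Qed.

(** Independence says that the joint law of (X, Y) and the product of the marginal laws agree on
    rectangles, hence everywhere by uniqueness of the product measure. Fubini then splits the
    integral of g(x) h(y). *)
Lemma expectation_indep (X Y : {mfun T >-> R}) (g h : R -> R) (M : R) :
  (forall A B : set R, measurable A -> measurable B ->
    P (X @^-1` A `&` Y @^-1` B) = (P (X @^-1` A) * P (Y @^-1` B))%E) ->
  measurable_fun setT g -> measurable_fun setT h ->
  (forall x, `|g x| <= M) -> (forall x, `|h x| <= M) ->
  \int[P]_w (g (X w) * h (Y w)) = \int[P]_w g (X w) * \int[P]_w h (Y w).
Proof.
move=> ind mg mh gM hM.
pose mu1 := distribution P X; pose mu2 := distribution P Y.
have mXY : measurable_fun setT (fun w => (X w, Y w)).
  by apply: measurable_fun_pair.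
pose XY : {mfun T >-> (R * R)%type} :=
  MeasurableFun.Pack (MeasurableFun.Class (isMeasurableFun.Build _ _ _ _ _ mXY)).
have mgh : measurable_fun setT (fun z : R * R => g z.1 * h z.2).
  by apply: measurable_funM; apply: measurableT_comp.
have bgh (z : R * R) : `|g z.1 * h z.2| <= M * M.
  by rewrite normrM ler_pM.
have prodE : forall A, measurable A -> (mu1 \x mu2)%E A = distribution P XY A.
  apply: product_measure_unique => A B mA mB.
  by rewrite -ind.
have int1 : (mu1 \x mu2)%E.-integrable setT (fun z : R * R => (g z.1 * h z.2)%:E).
  apply: measurable_bounded_integrable => //.
  - by rewrite [ltLHS](prodE setT measurableT) (le_lt_trans (probability_le1 _ measurableT))// ltry.
  - by exists (M * M); split => [|x Mx z _]; [exact: num_real|exact: le_trans (bgh z) (ltW Mx)].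
have intg (f : R -> R) (Z : {mfun T >-> R}) : measurable_fun setT f ->
    (forall x, `|f x| <= M) ->
    (\int[distribution P Z]_x (f x)%:E = (\int[P]_w f (Z w))%:E)%E.
  move=> mf fM.
  have fZ : P.-integrable setT (EFin \o (f \o Z)).
    apply: (@bounded_expectation_integrable _ M) => [|w]; last exact: fM.
    by apply: measurableT_comp.
  rewrite integral_pushforward//; last exact/measurable_EFinP.
  rewrite preimage_setT -[LHS]fineK//; exact: integrable_fin_num.
have intf (f : R -> R) (Z : {mfun T >-> R}) : measurable_fun setT f ->
    (forall x, `|f x| <= M) -> (distribution P Z).-integrable setT (EFin \o f).
  move=> mf fM; apply: measurable_bounded_integrable => //.
  - by rewrite (le_lt_trans (probability_le1 _ measurableT))// ltry.
  - by exists M; split => [|x Mx z _]; [exact: num_real|exact: le_trans (fM z) (ltW Mx)].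
have : (\int[mu1 \x mu2]_z (g z.1 * h z.2)%:E =
    (\int[P]_w (g (X w) * h (Y w)))%:E)%E.
  rewrite (eq_measure_integral (distribution P XY)); last by move=> A mA _; exact: prodE.
  have ff : P.-integrable setT (EFin \o (fun w => g (X w) * h (Y w))).
    apply: (@bounded_expectation_integrable _ (M * M)) => [|w]; last exact: (bgh (X w, Y w)).
    by apply: measurable_funM; apply: measurableT_comp.
  rewrite integral_pushforward//; last exact/measurable_EFinP.
  rewrite preimage_setT -[LHS]fineK//; exact: integrable_fin_num.
rewrite -integral12_prod_meas1//.
under eq_integral => x _.
  rewrite /fubini_F/=; under eq_integral do rewrite EFinM.
  rewrite integralZl//; last exact: intf.
  rewrite intg// -EFinM mulrC EFinM.
  over.
by rewrite /= integralZl//; [rewrite intg// -EFinM => -[<-]; rewrite mulrC|exact: intf].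
Qed.

End BoundedExpectation.

(** * Trigonometric functions of Brownian motion *)

Section BrownianTrigonometry.
Context {R : realType} {d : measure_display} {T : measurableType d}.
Variables (P : probability T R) (W : R -> T -> R).
Hypothesis W_bm : is_brownian P W.
Implicit Types (s t u b c x : R).

Local Notation mfunOf mX :=
  (MeasurableFun.Pack (MeasurableFun.Class (isMeasurableFun.Build _ _ _ _ _ mX))).

Lemma brownian_measurable t : 0 <= t <= 1 -> measurable_fun setT (W t).
Proof. by case: W_bm => h _; exact: h. Qed.

Lemma brownian_increment_measurable s t : 0 <= s -> s < t -> t <= 1 ->
  measurable_fun setT (fun w => W t w - W s w).
Proof.
move=> s0 st t1; apply: measurable_funB; apply: brownian_measurable.
  by rewrite t1 (le_trans s0 (ltW st)).
by rewrite s0 (le_trans (ltW st) t1).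
Qed.

Lemma expectation_increment s t (g : R -> R) (M : R) : 0 <= s -> s < t -> t <= 1 ->
  measurable_fun setT g -> (forall x, `|g x| <= M) ->
  \int[P]_w g (W t w - W s w) =
  \int[lebesgue_measure]_x (g x * normal_pdf 0 (Num.sqrt (t - s)) x).
Proof.
move=> s0 st t1 mg gM.
have mX : measurable_fun setT ((fun w => W t w - W s w) : T -> measurableTypeR R).
  exact: brownian_increment_measurable s0 st t1.
pose X : {mfun T >-> measurableTypeR R} := mfunOf mX.
have st0 : Num.sqrt (t - s) != 0 by rewrite gt_eqF// sqrtr_gt0 subr_gt0.
rewrite /Rintegral -integral_normal_prob//; last first.
  apply: measurable_bounded_integrable => //.
  - by rewrite (le_lt_trans (probability_le1 _ measurableT))// ltry.
  - by exists M; split => [|x Mx z _]; [exact: num_real|exact: le_trans (gM z) (ltW Mx)].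
transitivity (fine (\int[distribution P X]_x (g x)%:E)%E); last first.
  congr fine; apply: eq_measure_integral => A mA _.
  by case: W_bm => _ [_ [_ /(_ s t s0 st t1)[H _]]]; exact: H.
congr fine; rewrite integral_pushforward//; first exact/measurable_EFinP.
apply: (@bounded_expectation_integrable _ _ _ _ _ M) => [|w]; last exact: gM.
by apply: measurableT_comp.
Qed.

Lemma cos_norm_le1 x : `|cos x| <= 1.
Proof. by rewrite ler_norml cos_geN1 cos_le1. Qed.

Lemma sin_norm_le1 x : `|sin x| <= 1.
Proof. by rewrite ler_norml sin_geN1 sin_le1. Qed.

Lemma measurable_cosM b : measurable_fun setT (fun x : R => cos (b * x)).
Proof.
apply: continuous_measurable_fun => x.
apply: (@continuous_comp _ _ _ (fun x : R => b * x) cos); last exact: continuous_cos.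
by apply: cvgM; [exact: cvg_cst|exact: cvg_id].
Qed.

Lemma measurable_sinM b : measurable_fun setT (fun x : R => sin (b * x)).
Proof.
apply: continuous_measurable_fun => x.
apply: (@continuous_comp _ _ _ (fun x : R => b * x) sin); last exact: continuous_sin.
by apply: cvgM; [exact: cvg_cst|exact: cvg_id].
Qed.

Lemma expectation_cos_increment b s t : 0 <= s -> s < t -> t <= 1 ->
  \int[P]_w cos (b * (W t w - W s w)) = expR (- (b ^+ 2 * (t - s) / 2)).
Proof.
move=> s0 st t1.
rewrite (@expectation_increment s t (fun x => cos (b * x)) 1)//.
- rewrite normal_cos_transform ?sqr_sqrtr ?subr_ge0 ?(ltW st)//.
    by rewrite (mulrC (t - s)).
  by rewrite gt_eqF// sqrtr_gt0 subr_gt0.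
- exact: measurable_cosM.
- by move=> x; exact: cos_norm_le1.
Qed.

Lemma expectation_sin_increment b s t : 0 <= s -> s < t -> t <= 1 ->
  \int[P]_w sin (b * (W t w - W s w)) = 0.
Proof.
move=> s0 st t1.
rewrite (@expectation_increment s t (fun x => sin (b * x)) 1)//.
- by rewrite normal_sin_transform// gt_eqF// sqrtr_gt0 subr_gt0.
- exact: measurable_sinM.
- by move=> x; exact: sin_norm_le1.
Qed.

Lemma expectation_cst c : \int[P]_w c = c.
Proof.
have := @Rintegral_cst _ _ R P setT measurableT c.
by have /= -> := @probability_setT _ _ _ P; rewrite mulr1.
Qed.

Lemma expectation_cos b t : 0 <= t <= 1 ->
  \int[P]_w cos (b * W t w) = expR (- (b ^+ 2 * t / 2)).
Proof.
case: (W_bm) => _ [W0 _] /andP[t0 t1].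
have [->|tn0] := eqVneq t 0.
  under eq_Rintegral do rewrite W0 mulr0 cos0.
  by rewrite expectation_cst mulr0 mul0r oppr0 expR0.
rewrite -[in RHS](subr0 t) -expectation_cos_increment ?lt_neqAle ?t0 1?eq_sym ?tn0//.
by apply: eq_Rintegral => w _; rewrite W0 subr0.
Qed.

Lemma expectation_sin b t : 0 <= t <= 1 -> \int[P]_w sin (b * W t w) = 0.
Proof.
case: (W_bm) => _ [W0 _] /andP[t0 t1].
have [->|tn0] := eqVneq t 0.
  under eq_Rintegral do rewrite W0 mulr0 sin0.
  by rewrite expectation_cst.
have t0' : 0 < t by rewrite lt_neqAle eq_sym tn0.
rewrite -(expectation_sin_increment b (lexx 0) t0' t1).
by apply: eq_Rintegral => w _; rewrite W0 subr0.
Qed.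

Lemma integrable_cos b t : 0 <= t <= 1 ->
  P.-integrable setT (EFin \o (fun w => cos (b * W t w))).
Proof.
move=> t01; apply: (@bounded_expectation_integrable _ _ _ _ _ 1) => [|w].
  exact: measurableT_comp (measurable_cosM b) (brownian_measurable t01).
exact: cos_norm_le1.
Qed.

Lemma expectation_cos_cos b c t : 0 <= t <= 1 ->
  \int[P]_w (cos (b * W t w) * cos (c * W t w)) =
  (expR (- ((b - c) ^+ 2 * t / 2)) + expR (- ((b + c) ^+ 2 * t / 2))) / 2.
Proof.
move=> t01; rewrite -!expectation_cos// -RintegralD//; try exact: integrable_cos.
rewrite mulrC -RintegralZl//; last first.
  rewrite /comp; under eq_fun do rewrite EFinD.
  by apply: integrableD => //; exact: integrable_cos.
by apply: eq_Rintegral => w _; rewrite mulrBl mulrDl cosB cosD; field.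
Qed.

(* Conditioning on time t: the sine part of cos(c W_1) vanishes by symmetry. *)
Lemma expectation_cos_cos1 b c t : 0 <= t -> t < 1 ->
  \int[P]_w (cos (b * W t w) * cos (c * W 1 w)) =
  expR (- (c ^+ 2 * (1 - t) / 2)) *
  ((expR (- ((b - c) ^+ 2 * t / 2)) + expR (- ((b + c) ^+ 2 * t / 2))) / 2).
Proof.
move=> t0 t1; have t01 : 0 <= t <= 1 by rewrite t0 ltW.
have mI := brownian_increment_measurable t0 t1 (lexx 1).
pose X : {mfun T >-> R} := mfunOf (brownian_measurable t01).
pose Y : {mfun T >-> R} := mfunOf mI.
have ind (A B : set R) : measurable A -> measurable B ->
    P (X @^-1` A `&` Y @^-1` B) = (P (X @^-1` A) * P (Y @^-1` B))%E.
  move=> mA mB; case: (W_bm) => _ [_ [_ /(_ t 1 t0 t1 (lexx 1))[_ H]]].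
  apply: H => //; apply: sub_gen_smallest; exists t, A.
  by rewrite t0 lexx.
pose g1 x := cos (b * x) * cos (c * x).
pose g2 x := cos (b * x) * sin (c * x).
have m1 : measurable_fun setT g1 by apply: measurable_funM; exact: measurable_cosM.
have m2 : measurable_fun setT g2.
  by apply: measurable_funM; [exact: measurable_cosM|exact: measurable_sinM].
have b1 x : `|g1 x| <= 1 by rewrite normrM mulr_ile1// cos_norm_le1.
have b2 x : `|g2 x| <= 1 by rewrite normrM mulr_ile1// ?cos_norm_le1// sin_norm_le1.
have e1 := expectation_indep ind m1 (measurable_cosM c) b1 (fun x => cos_norm_le1 (c * x)).
have e2 := expectation_indep ind m2 (measurable_sinM c) b2 (fun x => sin_norm_le1 (c * x)).
have i1 : P.-integrable setT (EFin \o (fun w => g1 (X w) * cos (c * Y w))).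
  apply: (@bounded_expectation_integrable _ _ _ _ _ 1) => [|w].
    by apply: measurable_funM; [exact: measurableT_comp|
      exact: measurableT_comp (measurable_cosM c) mI].
  by rewrite normrM mulr_ile1// cos_norm_le1.
have i2 : P.-integrable setT (EFin \o (fun w => g2 (X w) * sin (c * Y w))).
  apply: (@bounded_expectation_integrable _ _ _ _ _ 1) => [|w].
    by apply: measurable_funM; [exact: measurableT_comp|
      exact: measurableT_comp (measurable_sinM c) mI].
  by rewrite normrM mulr_ile1// sin_norm_le1.
transitivity (\int[P]_w (g1 (X w) * cos (c * Y w) - g2 (X w) * sin (c * Y w))).
  apply: eq_Rintegral => w _; rewrite /g1 /g2/=.
  rewrite -[in LHS](subrK (W t w) (W 1 w)) (mulrDr c) cosD; ring.
rewrite RintegralB// e1 e2 /= expectation_sin_increment// mulr0 subr0.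
by rewrite expectation_cos_increment// mulrC expectation_cos_cos.
Qed.

Lemma heatF_sin_series (A b : nat -> R) C t x : (forall k, `|A k| <= C * 4^-1 ^+ k) ->
  0 <= t < 1 ->
  heatF P W (fun x => limn (series (fun k => A k * sin (b k * x)))) t x =
  limn (series (fun k => A k * expR (- (b k ^+ 2 * (1 - t) / 2)) * sin (b k * x))).
Proof.
move=> AC /andP[t0 t1]; have t01 : 0 <= 1 - t <= 1 by apply/andP; split; lra.
have mk k : measurable_fun setT (fun w => sin (b k * (x + W (1 - t) w))).
  apply: (measurableT_comp (measurable_sinM (b k))).
  by apply: measurable_funD => //; exact: brownian_measurable.
rewrite -[LHS]/(\int[P]_w limn (series (fun k => A k * sin (b k * (x + W (1 - t) w))))).
rewrite (@expectation_series _ _ _ _ (fun k w => A k * sin (b k * (x + W (1 - t) w))) C).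
- congr (limn (series _)); apply/funext => k.
  have iS : P.-integrable setT (EFin \o (fun w => sin (b k * W (1 - t) w))).
    apply: (@bounded_expectation_integrable _ _ _ _ _ 1) => [|w].
      exact: measurableT_comp (measurable_sinM _) (brownian_measurable t01).
    exact: sin_norm_le1.
  have iC := integrable_cos (b k) t01.
  rewrite RintegralZl//; last first.
    apply: (@bounded_expectation_integrable _ _ _ _ _ 1) => // w.
    exact: sin_norm_le1.
  rewrite -mulrA; congr (_ * _).
  transitivity (\int[P]_w (sin (b k * x) * cos (b k * W (1 - t) w)
      + cos (b k * x) * sin (b k * W (1 - t) w))).
    by apply: eq_Rintegral => w _; rewrite mulrDr sinD.
  rewrite RintegralD//; try by rewrite /comp; under eq_fun do rewrite EFinM; exact: integrableZl.
  by rewrite !RintegralZl// expectation_sin// expectation_cos// mulr0 addr0 mulrC.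
- by move=> k; apply: measurable_funM.
- by move=> k w; apply: le_trans (AC k); rewrite normrM ler_piMr// sin_norm_le1.
Qed.

Lemma mulr_expRN_le (y e : R) : 0 < e -> y * expR (- (y * e)) <= e^-1.
Proof.
move=> e0; rewrite expRN ler_pdivrMr ?expR_gt0// mulrC ler_pdivlMr//.
by apply: le_trans (expR_ge1Dx _); rewrite lerDr.
Qed.

(** For t < 1 the heat kernel pays for two derivatives: y e^(-ye) <= 1/e with y = b_k^2 and e =
    (1-t)/2. The domination required for termwise differentiation thus holds although the series for
    f itself may not be differentiable; the price is a constant blowing up as t tends to 1. *)
Lemma heat_coef_bound (A b : nat -> R) C t k : `|A k| <= C * 4^-1 ^+ k -> t < 1 ->
  `|A k * expR (- (b k ^+ 2 * (1 - t) / 2))| * b k ^+ 2 <= C * (2 / (1 - t)) * 4^-1 ^+ k.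
Proof.
move=> AC t1; rewrite normrM (ger0_norm (expR_ge0 _)) -(mulrA `|_|) [leRHS]mulrAC.
apply: ler_pM => //; first by rewrite mulr_ge0 ?expR_ge0 ?sqr_ge0.
have e0 : 0 < (1 - t) / 2 by rewrite divr_gt0// subr_gt0.
by rewrite -(mulrA (b k ^+ 2)) (mulrC (expR _)) -[X in _ <= X]invf_div; exact: mulr_expRN_le.
Qed.

Lemma phi_sin_series (A b : nat -> R) C t w : (forall k, 1 <= b k) ->
  (forall k, `|A k| <= C * 4^-1 ^+ k) -> 0 <= t < 1 ->
  phi P W (fun x => limn (series (fun k => A k * sin (b k * x)))) t w =
  limn (series (fun k => A k * expR (- (b k ^+ 2 * (1 - t) / 2)) * b k
                         * cos (b k * W t w))).
Proof.
move=> b1 AC t01; rewrite /phi.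
have -> : heatF P W (fun x => limn (series (fun k => A k * sin (b k * x)))) t =
  fun x => limn (series (fun k => A k * expR (- (b k ^+ 2 * (1 - t) / 2)) * sin (b k * x))).
  by apply/funext => x; exact: heatF_sin_series AC t01.
rewrite derive1E.
have dom k : `|A k * expR (- (b k ^+ 2 * (1 - t) / 2))| * b k ^+ 2
    <= C * (2 / (1 - t)) * 4^-1 ^+ k.
  by apply: heat_coef_bound; [exact: AC|case/andP: t01].
by case: (is_derive_sin_series (W t w) b1 dom).
Qed.

End BrownianTrigonometry.

(** * Interpolation space membership of the lacunary series *)

Section DyadicIntegral.
Context {d : measure_display} {T : measurableType d} {R : realType}.
Variable mu : {measure set T -> \bar R}.

(** The integral of a nonnegative function is a supremum over simple functions below it, so
    monotonicity holds without measurability. This matters for [Kfun] and [bmo_sup], an infimum and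
    a supremum over uncountable families. *)
Lemma le_integral_nonmeasurable (D : set T) (f g : T -> \bar R) :
  (forall x, D x -> (0 <= f x)%E) -> (forall x, D x -> (f x <= g x)%E) ->
  (\int[mu]_(x in D) f x <= \int[mu]_(x in D) g x)%E.
Proof.
move=> f0 fg; rewrite !ge0_integralE//; last first.
  by move=> x Dx; exact: le_trans (f0 _ Dx) (fg _ Dx).
apply: le_ereal_sup => _ [h hf <-]; exists h => // x.
apply: le_trans (hf x) _; rewrite !patchE; case: ifPn => //.
by rewrite inE; exact: fg.
Qed.

(** Comparison with a countable sum of step functions. Two families of sets are allowed so that the
    two ends of the half-line, lambda near 0 and lambda near infinity, are handled together. *)
Lemma integral_step_cover_lty (D : set T) (g : T -> \bar R) (I J : nat -> set T)
    (v w u : nat -> R) (M : R) :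
  measurable D -> (forall x, D x -> (0 <= g x)%E) ->
  (forall n, measurable (I n)) -> (forall n, measurable (J n)) ->
  (forall n, 0 <= v n) -> (forall n, 0 <= w n) ->
  (forall n, ((v n)%:E * mu (I n) + (w n)%:E * mu (J n) <= (u n)%:E)%E) ->
  (forall n, series u n <= M) ->
  (forall x, D x -> exists n,
     (I n x /\ (g x <= (v n)%:E)%E) \/ (J n x /\ (g x <= (w n)%:E)%E)) ->
  (\int[mu]_(x in D) g x < +oo)%E.
Proof.
move=> mD g0 mI mJ v0 w0 vwu uM cover.
pose F n x := (v n * \1_(I n) x + w n * \1_(J n) x)%:E.
have F0 n x : (0 <= F n x)%E.
  by rewrite lee_fin addr_ge0// mulr_ge0.
have mF n : measurable_fun D (F n).
  by apply/measurable_EFinP; apply: measurable_funD; apply: measurable_funM => //;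
    exact: measurable_indic.
apply: (@le_lt_trans _ _ (\int[mu]_(x in D) \sum_(n <oo) F n x)%E).
  apply: le_integral_nonmeasurable => // x Dx.
  have [n H] := cover x Dx.
  have : (g x <= F n x)%E.
    case: H => -[Ix] /le_trans; apply; rewrite lee_fin.
      by rewrite [\1_(I n) x]indicE mem_set// mulr1 lerDl mulr_ge0.
    by rewrite [\1_(J n) x]indicE mem_set// mulr1 lerDr mulr_ge0.
  move=> /le_trans; apply; apply: le_trans (nneseries_lim_ge n.+1 _) => //.
  by rewrite big_nat_recr//= leeDr// sume_ge0.
rewrite integral_nneseries//.
apply: (@le_lt_trans _ _ M%:E); last exact: ltry.
apply: lime_le; first by apply: is_cvg_nneseries => n _ _; exact: integral_ge0.
apply: nearW => n.
apply: (@le_trans _ _ (series u n)%:E); last by rewrite lee_fin.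
rewrite /series/= -sumEFin; apply: lee_sum => k _.
apply: le_trans (vwu k).
rewrite /F; under eq_integral do rewrite EFinD.
rewrite ge0_integralD//=; first last.
- by apply/measurable_EFinP; apply: measurable_funM => //; exact: measurable_indic.
- by move=> x _; rewrite lee_fin mulr_ge0.
- by apply/measurable_EFinP; apply: measurable_funM => //; exact: measurable_indic.
- by move=> x _; rewrite lee_fin mulr_ge0.
apply: leeD; under eq_integral do rewrite EFinM.
- rewrite ge0_integralZl_EFin//; last by apply/measurable_EFinP; exact: measurable_indic.
  rewrite integral_indic// lee_wpmul2l ?lee_fin//.
  by apply: le_measure; rewrite ?inE//; exact: measurableI.
- rewrite ge0_integralZl_EFin//; last by apply/measurable_EFinP; exact: measurable_indic.
  rewrite integral_indic// lee_wpmul2l ?lee_fin//.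
  by apply: le_measure; rewrite ?inE//; exact: measurableI.
Qed.

End DyadicIntegral.

(** * Summability of powers of the weights *)

Section Weights.
Context {R : realType}.

(* Square roots of the harmonic weights: in l^r for every r > 2 but not in l^2. *)
Definition weight (n : nat) : R := n.+1%:R `^ (- 2^-1).

Lemma weight_gt0 n : 0 < weight n.
Proof. by rewrite powR_gt0. Qed.

Lemma weight_ge0 n : 0 <= weight n.
Proof. exact/ltW/weight_gt0. Qed.

Lemma weight_le m n : (m <= n)%N -> weight n <= weight m.
Proof.
move=> mn; rewrite /weight !powRN lef_pV2 ?posrE ?powR_gt0//.
by rewrite ge0_ler_powR ?nnegrE// ler_nat.
Qed.

Lemma weight_le1 n : weight n <= 1.
Proof. by apply: le_trans (weight_le (leq0n n)) _; rewrite /weight powR1. Qed.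

(** A crude form of n + 2 <= 4 (n + 1) under the square root. The loss of a factor 2 per step is
    what D >= 4 can afford in the Lipschitz estimate. *)
Lemma weight_le_succ n : weight n <= 2 * weight n.+1.
Proof.
have two : (4 : R) `^ 2^-1 = 2.
  by rewrite powR12_sqrt// -[4%:R](_ : (2 : R) ^+ 2 = _) ?sqrtr_sqr ?ger0_norm//; ring.
rewrite /weight -[X in _ <= X * _]two; set h := 2^-1.
rewrite !powRN ler_pdivlMr ?powR_gt0// mulrC ler_pdivrMr ?powR_gt0//.
rewrite -powRM// ge0_ler_powR ?nnegrE// ?invr_ge0// -natrM ler_nat.
by rewrite mulSn ltnS; case: n => // n; rewrite -addn1 leq_add2l.
Qed.

Lemma weight_powR n (r : R) : weight n `^ r = (n.+1%:R `^ (r / 2))^-1.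
Proof. by rewrite /weight -powRrM mulNr mulrC powRN. Qed.

Lemma weight_sqr n : weight n ^+ 2 = n.+1%:R^-1.
Proof.
by rewrite -powR_mulrn ?weight_ge0// weight_powR divff// powRr1.
Qed.

(** Discrete counterpart of comparing s x^(-1-s) with its integral over [n+1, n+2]. It follows from
    ln(n+2) - ln(n+1) >= 1/(n+2) and e^x >= 1 + x. *)
Lemma inv_powR_telescope n (s : R) : 0 < s ->
  s * (n.+2%:R `^ (1 + s))^-1 <= (n.+1%:R `^ s)^-1 - (n.+2%:R `^ s)^-1.
Proof.
move=> s0; rewrite powRD ?pnatr_eq0 ?implybT// powRr1// invfM.
have lnD : n.+2%:R^-1 <= ln (n.+2%:R) - ln (n.+1%:R) :> R.
  rewrite -ln_div ?posrE// -[leLHS]opprK lerNl -lnV ?posrE ?divr_gt0// invf_div.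
  have -> : n.+1%:R / n.+2%:R = 1 + - n.+2%:R^-1 :> R.
    by rewrite -[n.+1%:R](addrK 1) natr1 mulrBl divff ?pnatr_eq0// mul1r.
  by apply: le_ln1Dx; rewrite ltrN2 invf_lt1// ltr1n.
have E m : (m.+1%:R `^ s)^-1 = expR (- (s * ln m.+1%:R)) :> R.
  by rewrite /powR pnatr_eq0/= expRN.
rewrite !E lerBrDr.
have -> : - (s * ln n.+1%:R) = - (s * ln n.+2%:R) + s * (ln n.+2%:R - ln n.+1%:R) :> R.
  by ring.
rewrite expRD; set e := expR (- _).
apply: (@le_trans _ _ (e * (1 + s * (ln n.+2%:R - ln n.+1%:R)))).
  rewrite [leRHS](_ : _ = s * ((ln n.+2%:R - ln n.+1%:R) * e) + e); last by ring.
  by rewrite lerD2r ler_wpM2l ?(ltW s0)// ler_wpM2r ?expR_ge0.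
by rewrite ler_wpM2l ?expR_ge0// expR_ge1Dx.
Qed.

Lemma weight_powR_summable (r : R) : 2 < r ->
  exists M, forall n, series (fun k => weight k `^ r) n <= M.
Proof.
move=> r2; pose s := r / 2 - 1.
have s0 : 0 < s by rewrite /s; lra.
have rs : r / 2 = 1 + s by rewrite /s; lra.
exists (1 + s^-1) => n.
suff H : series (fun k => weight k `^ r) n.+1 <= 1 + s^-1 * (1 - (n.+1%:R `^ s)^-1).
  apply: (@le_trans _ _ (series (fun k => weight k `^ r) n.+1)).
    by rewrite seriesS lerDr powR_ge0.
  apply: le_trans H _; rewrite lerD2l ler_piMr ?invr_ge0 ?(ltW s0)//.
elim: n => [|n IH].
  by rewrite /series/= big_nat1 weight_powR !powR1 invr1 subrr mulr0 addr0.
rewrite seriesS addrC; apply: le_trans (lerD IH (lexx _)) _.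
rewrite weight_powR rs -addrA lerD2l.
have := inv_powR_telescope n s0; rewrite -ler_pdivlMl// => H.
by rewrite -lerBrDl -mulrBr; apply: le_trans H _; rewrite ler_wpM2l ?invr_ge0 ?(ltW s0)//; lra.
Qed.

End Weights.

Lemma geometric_bracket {R : realType} (b lam : R) : 1 < b -> 1 <= lam ->
  exists n, b ^+ n <= lam <= b ^+ n.+1.
Proof.
move=> b_gt1 l1; have b_gt0 : 0 < b := lt_trans ltr01 b_gt1.
have ex : exists n, lam < b ^+ n.
  have b1 : 0 <= b - 1 by rewrite subr_ge0 ltW.
  have H n : n%:R * (b - 1) <= b ^+ n.
    elim: n => [|n IH]; first by rewrite mul0r.
    rewrite exprS -natr1 mulrDl mul1r.
    have : 1 <= b ^+ n by rewrite exprn_ege1// ltW.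
    move=> h; apply: (@le_trans _ _ (b ^+ n + (b - 1) * b ^+ n)); last by nra.
    by apply: lerD => //; rewrite ler_peMr.
  have b1' : 0 < b - 1 by rewrite subr_gt0.
  exists (Num.truncn (lam / (b - 1))).+1; apply: lt_le_trans (H _).
  by rewrite -ltr_pdivrMr// truncnS_gt.
case: (ex_minnP ex) => m hm min {ex}; case: m hm min => [|m] hm min.
  by move: hm; rewrite expr0 ltNge l1.
exists m; rewrite (ltW hm) andbT leNgt; apply/negP => /min; by rewrite ltnn.
Qed.

(** * The lacunary series and its K-functional *)

Section Lacunary.
Context {R : realType}.
Implicit Types (x y lam : R) (n k : nat).

Definition lacunary_coef (B : R) k : R := weight k / B ^+ k.

Definition lacunary_head (B b : R) n x : R :=
  series (fun k => lacunary_coef B k * sin (b ^+ k * x)) n.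

Definition lacunary (B b : R) x : R :=
  limn (series (fun k => lacunary_coef B k * sin (b ^+ k * x))).

Variables (theta b B D : R).
Hypotheses (theta01 : 0 < theta < 1) (B_ge4 : 4 <= B) (D_ge4 : 4 <= D)
  (bBD : b = B * D) (B_def : b `^ theta = B).

Let f := lacunary B b.
Let A := lacunary_coef B.

Let B_gt0 : 0 < B. Proof. exact: lt_le_trans (ltr0n R 4) B_ge4. Qed.
Let D_gt0 : 0 < D. Proof. exact: lt_le_trans (ltr0n R 4) D_ge4. Qed.
Let b_gt1 : 1 < b. Proof. by rewrite bBD; have := B_ge4; have := D_ge4; nra. Qed.
Let b_gt0 : 0 < b. Proof. exact: lt_trans b_gt1. Qed.

Lemma lacunary_coef_ge0 k : 0 <= A k.
Proof. by rewrite divr_ge0 ?weight_ge0// exprn_ge0// ltW. Qed.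

(** Only the first coefficient of the tail is kept exact; after it, the weights decrease and B >= 4.
    The factor 4^n is there to cancel the 4^(-n) that [geom_dom_tail] produces. *)
Lemma lacunary_coef_tail n k : (n <= k)%N -> A k <= weight n / B ^+ n * 4 ^+ n * 4^-1 ^+ k.
Proof.
move=> nk; rewrite /A /lacunary_coef -(subnKC nk) !exprD invfM !mulrA.
have e4 : (4 : R) ^+ n * 4^-1 ^+ n = 1 by rewrite -exprMn divff// expr1n.
rewrite [leRHS](_ : _ = weight n * (B ^+ n)^-1 * (4 ^+ n * 4^-1 ^+ n) * 4^-1 ^+ (k - n));
  last by ring.
rewrite e4 mulr1; apply: ler_pM.
- by rewrite divr_ge0 ?weight_ge0// exprn_ge0// ltW.
- by rewrite invr_ge0 exprn_ge0// ltW.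
- rewrite ler_wpM2r//; first by rewrite invr_ge0 exprn_ge0// ltW.
  exact/weight_le/leq_addr.
- rewrite -exprVn lerXn2r ?nnegrE ?invr_ge0 ?(ltW B_gt0)//.
  by rewrite lef_pV2 ?posrE.
Qed.

Lemma lacunary_coef_le k : `|A k| <= 1 * 4^-1 ^+ k.
Proof.
rewrite ger0_norm ?lacunary_coef_ge0// (le_trans (lacunary_coef_tail (leq0n k)))//.
by rewrite !expr0 divr1 mulr1 ler_wpM2r ?quarter_ge0// weight_le1.
Qed.

Lemma lacunary_term_le k x : `|A k * sin (b ^+ k * x)| <= `|A k|.
Proof. by rewrite normrM ler_piMr// ler_norml sin_geN1 sin_le1. Qed.

Lemma lacunary_cvg x : cvgn (series (fun k => A k * sin (b ^+ k * x))).
Proof.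
apply: (@geom_dom_cvg _ 1) => k.
exact: le_trans (lacunary_term_le k x) (lacunary_coef_le k).
Qed.

Lemma lacunary_tail_le n x : `|f x - lacunary_head B b n x| <= 2 * weight n / B ^+ n.
Proof.
have tl k : (n <= k)%N ->
    `|A k * sin (b ^+ k * x)| <= weight n / B ^+ n * 4 ^+ n * 4^-1 ^+ k.
  move=> nk; apply: le_trans (lacunary_term_le k x) _.
  by rewrite ger0_norm ?lacunary_coef_ge0//; exact: lacunary_coef_tail.
have /le_trans := geom_dom_tail tl (@lacunary_cvg x); apply.
have e4 : (4 : R) ^+ n * 4^-1 ^+ n = 1 by rewrite -exprMn divff// expr1n.
by rewrite -mulrA -(mulrA (weight n / _)) e4 mulr1 mulrA.
Qed.

(** Mode n has Lipschitz constant at most A_n b^n = c_n D^n, as large as the bound for the head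
    before it. Adding mode n therefore doubles the bound, and 2 c_n D^n <= 4 c_(n+1) D^n <= c_(n+1)
    D^(n+1) closes the induction. *)
Lemma lacunary_head_lip n x y :
  `|lacunary_head B b n x - lacunary_head B b n y| <= weight n * D ^+ n * `|x - y|.
Proof.
elim: n => [|n IH].
  by rewrite /lacunary_head /series/= !big_geq// subrr normr0 !mulr_ge0 ?weight_ge0.
pose s := A n * sin (b ^+ n * x); pose s' := A n * sin (b ^+ n * y).
have -> : lacunary_head B b n.+1 x - lacunary_head B b n.+1 y =
    (s - s') + (lacunary_head B b n x - lacunary_head B b n y).
  by rewrite /lacunary_head !seriesS -/A -/s -/s'; ring.
have ss : `|s - s'| <= weight n * D ^+ n * `|x - y|.
  rewrite -mulrBr normrM ger0_norm ?lacunary_coef_ge0//.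
  have -> : b ^+ n * x = b ^+ n * y + b ^+ n * (x - y) by ring.
  apply: (@le_trans _ _ (A n * `|b ^+ n * (x - y)|)).
    by rewrite ler_wpM2l ?lacunary_coef_ge0// sin_diff_le.
  rewrite normrM (ger0_norm (exprn_ge0 _ (ltW b_gt0))) mulrA ler_wpM2r//.
  rewrite /A /lacunary_coef bBD exprMn mulrA divfK//.
  by rewrite expf_neq0// gt_eqF.
apply: le_trans (ler_normD _ _) _; apply: le_trans (lerD ss IH) _.
rewrite -mulrDl ler_wpM2r// exprS.
have := @weight_le_succ R n; have := exprn_ge0 n (ltW D_gt0).
have := @weight_ge0 R n.+1; set w := weight n; set w' := weight n.+1.
set p := D ^+ n => w0 p0 ww.
have h1 : w * p <= 2 * w' * p by rewrite ler_wpM2r.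
have h2 : 4 * (w' * p) <= D * (w' * p) by rewrite ler_wpM2r// mulr_ge0.
by rewrite mulrCA; lra.
Qed.

Lemma lip_continuous (g : R -> R) (L : R) :
  (forall x y, `|g x - g y| <= L * `|x - y|) -> continuous g.
Proof.
move=> gL x; apply/cvgrPdist_le => e e0; near=> y.
have L0 : 0 < `|L| + 1 by rewrite ltr_wpDl.
apply: le_trans (gL x y) _.
apply: (@le_trans _ _ ((`|L| + 1) * `|x - y|)).
  by rewrite ler_wpM2r// (le_trans (ler_norm L))// lerDl.
rewrite mulrC -ler_pdivlMr//.
by near: y; apply: cvgr_dist_le => //; rewrite divr_gt0.
Unshelve. all: by end_near. Qed.

Lemma lacunary_continuous : continuous f.
Proof.
move=> x; apply/cvgrPdist_le => e e0.
have e3 : 0 < e / 3 by rewrite divr_gt0.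
have [n hn] : exists n, 2 * weight n / B ^+ n <= e / 3.
  have : 2 * (4^-1 : R) ^+ n @[n --> \oo] --> 2 * (0 : R).
    by apply: cvgMl_tmp; apply: cvg_expr; rewrite ger0_norm ?invr_ge0// invf_lt1 ?ltr1n.
  rewrite mulr0 => /cvgr0_norm_le/(_ _ e3)[n _ /(_ n (leqnn n))/= H].
  exists n; apply: le_trans (le_trans (ler_norm _) H).
  rewrite -mulrA ler_wpM2l//; have := lacunary_coef_le n.
  by rewrite mul1r ger0_norm ?lacunary_coef_ge0.
near=> y.
have -> : f x - f y = (f x - lacunary_head B b n x) +
    (lacunary_head B b n x - lacunary_head B b n y) - (f y - lacunary_head B b n y).
  by ring.
have hxy : `|lacunary_head B b n x - lacunary_head B b n y| <= e / 3.
  near: y; have := lip_continuous (lacunary_head_lip n).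
  by move=> /(_ x)/cvgr_dist_le; apply.
apply: le_trans (ler_normB _ _) _; apply: (@le_trans _ _ (e / 3 + e / 3 + e / 3)); last by lra.
apply: lerD; last exact: le_trans (lacunary_tail_le n y) hn.
apply: le_trans (ler_normD _ _) _; apply: lerD => //.
exact: le_trans (lacunary_tail_le n x) hn.
Unshelve. all: by end_near. Qed.

Lemma lacunary_head0 n : lacunary_head B b n 0 = 0.
Proof. by rewrite /lacunary_head /series/= big1// => k _; rewrite mulr0 sin0 mulr0. Qed.

Lemma lacunary0 : f 0 = 0.
Proof.
rewrite /f /lacunary; under eq_fun do rewrite mulr0 sin0 mulr0.
apply/cvg_lim => //; apply: cvg_near_cst; apply: nearW => n.
by rewrite /series/= big1.
Qed.

Lemma lacunary_tail_Cb0 n : Cb0 (fun x => f x - lacunary_head B b n x).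
Proof.
split; last split.
- move=> x; apply: cvgB; first exact: lacunary_continuous.
  exact: (lip_continuous (lacunary_head_lip n)).
- by exists (2 * weight n / B ^+ n) => x; exact: lacunary_tail_le.
- by rewrite lacunary_head0 lacunary0 subrr.
Qed.

Lemma lacunary_head_Lip0 n : Lip0 (lacunary_head B b n).
Proof.
split; last exact: lacunary_head0.
by exists (weight n * D ^+ n) => x y; exact: lacunary_head_lip.
Qed.

Lemma lacunary_split n :
  f = (fun x => f x - lacunary_head B b n x) \+ lacunary_head B b n.
Proof. by apply/funext => x /=; rewrite subrK. Qed.

Lemma Kfun_ge0 lam (g : R -> R) : 0 <= lam -> (0 <= Kfun lam g)%E.
Proof.
move=> l0; apply: le_ereal_inf_tmp => _ [f0 [f1 [_ [_ [_ ->]]]]].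
(* Explicit points are supplied for both suprema, since a supremum over the empty set would be minus
   infinity. *)
apply: adde_ge0.
  by apply: le_ereal_sup_tmp; exists (`|f0 0|)%:E; [exists 0|rewrite lee_fin].
apply: mule_ge0; first by rewrite lee_fin.
apply: le_ereal_sup_tmp; exists (`|f1 0 - f1 1| / `|0 - 1|)%:E; last by rewrite lee_fin.
by exists 0, 1; rewrite eq_sym oner_eq0.
Qed.

Lemma Kfun_lacunary_le lam n : 0 <= lam ->
  (Kfun lam f <= (2 * weight n / B ^+ n + lam * (weight n * D ^+ n))%:E)%E.
Proof.
move=> l0; apply: ge_ereal_inf.
exists (sup_norm (fun x => (f x - lacunary_head B b n x)%R) +
  lam%:E * lip_const (lacunary_head B b n))%E.
  exists (fun x => f x - lacunary_head B b n x), (lacunary_head B b n).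
  by split; [exact: lacunary_tail_Cb0|split; [exact: lacunary_head_Lip0|
    split; [exact: lacunary_split|]]].
rewrite EFinD; apply: leeD.
  by apply: ge_ereal_sup => _ [x _ <-]; rewrite lee_fin; exact: lacunary_tail_le.
rewrite EFinM lee_wpmul2l ?lee_fin//.
apply: ge_ereal_sup => _ [x [y [xy ->]]]; rewrite lee_fin ler_pdivrMr ?normr_gt0 ?subr_eq0//.
exact: lacunary_head_lip.
Qed.

(** The split at 0 puts all of f into the bounded part and leaves a zero Lipschitz part, so the
    bound is free of [lam]. This is the right split for lambda >= 1, where there is no oscillation
    left to trade. *)
Lemma Kfun_lacunary_le2 lam : 0 <= lam -> (Kfun lam f <= 2%:E)%E.
Proof.
move=> l0; apply: ge_ereal_inf.
exists (sup_norm (fun x => (f x - lacunary_head B b 0 x)%R) +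
  lam%:E * lip_const (lacunary_head B b 0))%E.
  exists (fun x => f x - lacunary_head B b 0 x), (lacunary_head B b 0).
  by split; [exact: lacunary_tail_Cb0|split; [exact: lacunary_head_Lip0|
    split; [exact: lacunary_split|]]].
rewrite -[leRHS]adde0; apply: leeD.
  apply: ge_ereal_sup => _ [x _ <-]; rewrite lee_fin.
  apply: le_trans (lacunary_tail_le 0 x) _.
  by rewrite expr0 divr1 ler_piMr// weight_le1.
rewrite -[leRHS](mule0 lam%:E) lee_wpmul2l ?lee_fin//.
apply: ge_ereal_sup => _ [x [y [_ ->]]].
by rewrite /lacunary_head /series/= !big_geq// subrr normr0 mul0r.
Qed.

Lemma powR_b_theta n : (b ^+ n) `^ theta = B ^+ n.
Proof.
by rewrite -powR_mulrn ?(ltW b_gt0)// powRAC B_def powR_mulrn// ltW.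
Qed.

(** At lambda <= b^(-n) the Lipschitz cost lambda c_n D^n is at most c_n B^(-n) because b = B D,
    which together with the tail gives 2 + 1 = 3. The scaling lambda^(-theta) is at most B^(n+1),
    one power of [B] too many because lambda may reach down to b^(-n-1). *)
Lemma lacunary_scaled_K_small lam n : b ^- n.+1 <= lam <= b ^- n ->
  lam `^ (- theta) * fine (Kfun lam f) <= 3 * B * weight n.
Proof.
have [t0 t1] := andP theta01.
move=> /andP[ln nl].
have l0 : 0 < lam by apply: lt_le_trans ln; rewrite invr_gt0 exprn_gt0.
have K0 := Kfun_ge0 f (ltW l0).
have Kn : fine (Kfun lam f) <= 3 * weight n / B ^+ n.
  have := Kfun_lacunary_le n (ltW l0); case: (Kfun lam f) K0 => //= k _.
  rewrite lee_fin => /le_trans; apply.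
  have : lam * (weight n * D ^+ n) <= weight n / B ^+ n.
    apply: (@le_trans _ _ (b ^- n * (weight n * D ^+ n))).
      by rewrite ler_wpM2r// mulr_ge0 ?weight_ge0// exprn_ge0// ltW.
    rewrite bBD exprMn invfM le_eqVlt; apply/orP; left; apply/eqP.
    by field; rewrite !expf_neq0// gt_eqF.
  by move=> h; lra.
have lt : lam `^ (- theta) <= B ^+ n.+1.
  rewrite powRN -powR_b_theta -[leRHS]invrK lef_pV2 ?posrE ?invr_gt0 ?powR_gt0 ?exprn_gt0//.
  rewrite -powRN -[b ^+ n.+1]invrK -powR_inv1 ?invr_ge0 ?exprn_ge0 ?(ltW b_gt0)//.
  rewrite -powRrM mulN1r opprK.
  by rewrite ge0_ler_powR ?nnegrE ?(ltW t0) ?(ltW l0)// invr_ge0 exprn_ge0// ltW.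
apply: (@le_trans _ _ (B ^+ n.+1 * (3 * weight n / B ^+ n))).
  by apply: ler_pM => //; [exact: powR_ge0|exact: fine_ge0].
rewrite exprS le_eqVlt; apply/orP; left; apply/eqP.
by field; rewrite expf_neq0// gt_eqF.
Qed.

Lemma lacunary_scaled_K_large lam n : b ^+ n <= lam ->
  lam `^ (- theta) * fine (Kfun lam f) <= 2 / B ^+ n.
Proof.
have [t0 t1] := andP theta01.
move=> nl.
have l0 : 0 < lam by apply: lt_le_trans nl; rewrite exprn_gt0.
have K0 := Kfun_ge0 f (ltW l0).
have Kn : fine (Kfun lam f) <= 2.
  by have := Kfun_lacunary_le2 (ltW l0); case: (Kfun lam f) K0.
have lt : lam `^ (- theta) <= (B ^+ n)^-1.
  rewrite powRN -powR_b_theta lef_pV2 ?posrE ?powR_gt0 ?exprn_gt0//.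
  by rewrite ge0_ler_powR ?nnegrE ?(ltW t0) ?(ltW l0)// exprn_ge0// ltW.
rewrite mulrC; apply: ler_pM => //; [exact: fine_ge0|exact: powR_ge0].
Qed.

Lemma lacunary_interp (q : \bar R) : (2%:E < q)%E -> interp_space theta q f.
Proof.
have [t0 t1] := andP theta01.
move=> q2; split.
  exists (fun x => f x - lacunary_head B b 0 x), (lacunary_head B b 0).
  split; first exact: lacunary_tail_Cb0.
  by split; [exact: lacunary_head_Lip0|exact: lacunary_split].
have small lam : 0 < lam -> lam < 1 -> exists n, b ^- n.+1 <= lam <= b ^- n.
  move=> l0 l1; have [|n /andP[n1 n2]] := @geometric_bracket R b lam^-1 b_gt1.
    by rewrite invf_ge1// ltW.
  exists n; rewrite -[lam]invrK !lef_pV2 ?posrE ?invr_gt0 ?exprn_gt0//.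
  by rewrite n1 n2.
case: q q2 => [r|_|//].
- rewrite lte_fin => r2; have r0 : 0 <= r by lra.
  have [M HM] := @weight_powR_summable R r r2.
  (* Each interval of the cover has mass at most b under the majorant of dlambda/lambda, whence the
     factor [b] in both constants. For large lambda the extra factor B^(-nr) is at most 4^(-n),
     since r >= 1. *)
  pose c := (3 * B) `^ r * b.
  pose c' := 2 `^ r * b.
  have c0 : 0 <= c by rewrite mulr_ge0 ?powR_ge0// ltW.
  have c'0 : 0 <= c' by rewrite mulr_ge0 ?powR_ge0// ltW.
  apply: (@integral_step_cover_lty _ _ R lebesgue_measure `]0%R, +oo[%classic _
    (fun n => `[b ^- n.+1, b ^- n]%classic) (fun n => `[b ^+ n, b ^+ n.+1]%classic)
    (fun n => (3 * B * weight n) `^ r * b ^+ n.+1)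
    (fun n => (2 / B ^+ n) `^ r / b ^+ n)
    (fun n => c * weight n `^ r + c' * 4^-1 ^+ n)
    (c * M + c' * 2)).
  + exact: measurable_itv.
  + move=> lam /=; rewrite in_itv/= andbT => l0.
    by rewrite lee_fin divr_ge0 ?powR_ge0// ltW.
  + by move=> n; exact: measurable_itv.
  + by move=> n; exact: measurable_itv.
  + by move=> n; rewrite mulr_ge0 ?powR_ge0// exprn_ge0// ltW.
  + by move=> n; rewrite divr_ge0 ?powR_ge0// exprn_ge0// ltW.
  + move=> n /=.
    have bn : 0 < b ^+ n by rewrite exprn_gt0.
    have bS : b ^+ n < b ^+ n.+1 by rewrite exprS ltr_pMl.
    have bSV : b ^- n.+1 < b ^- n by rewrite ltf_pV2 ?posrE ?exprn_gt0.
    rewrite !lebesgue_measure_itv/= !lte_fin bS bSV -!EFinB -!EFinM -EFinD lee_fin.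
    apply: lerD.
    * apply: (@le_trans _ _ ((3 * B * weight n) `^ r * b ^+ n.+1 * b ^- n)).
        rewrite ler_wpM2l ?mulr_ge0 ?powR_ge0 ?exprn_ge0 ?(ltW b_gt0)//.
        by rewrite gerBl invr_ge0 exprn_ge0// ltW.
      rewrite -mulrA exprS mulfK ?gt_eqF// powRM ?weight_ge0 ?mulr_ge0 ?(ltW B_gt0)//.
      by rewrite /c mulrAC.
    * apply: (@le_trans _ _ ((2 / B ^+ n) `^ r / b ^+ n * b ^+ n.+1)).
        by rewrite ler_wpM2l ?mulr_ge0 ?powR_ge0 ?invr_ge0 ?ltW// gtrBl.
      rewrite powRM ?invr_ge0 ?exprn_ge0 ?(ltW B_gt0)// exprS.
      set e := (B ^- n) `^ r; set p := b ^+ n.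
      rewrite [leLHS](_ : _ = c' * e); last by rewrite /c'; field; rewrite gt_eqF.
      rewrite ler_wpM2l//.
      apply: (@le_trans _ _ (B ^- n)).
        rewrite /e ge1r_powR//; last by lra.
        rewrite invr_gt0 exprn_gt0//= invf_le1 ?exprn_gt0// exprn_ege1//.
        by have := B_ge4; lra.
      rewrite -exprVn lerXn2r ?nnegrE ?invr_ge0 ?(ltW B_gt0)//.
      by rewrite lef_pV2 ?posrE.
  + move=> n; rewrite /series/= big_split/= -!mulr_sumr; apply: lerD.
      by rewrite ler_wpM2l//; exact: HM.
    by rewrite ler_wpM2l//; have := @sum_quarter_lt R 0 n; rewrite expr0 mulr1.
  + move=> lam /=; rewrite in_itv/= andbT => l0.
    have K0 : 0 <= lam `^ (- theta) * fine (Kfun lam f).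
      by rewrite mulr_ge0 ?powR_ge0// fine_ge0// Kfun_ge0// ltW.
    have [l1|l1] := ltP lam 1.
      have [n hn] := small _ l0 l1; exists n; left; split.
        by rewrite /= in_itv.
      have [n1 n2] := andP hn.
      rewrite lee_fin; apply: ler_pM; rewrite ?powR_ge0 ?invr_ge0 ?(ltW l0)//.
        rewrite ge0_ler_powR ?nnegrE//; last exact: lacunary_scaled_K_small.
        by rewrite !mulr_ge0 ?weight_ge0// ltW.
      by rewrite -[leRHS]invrK lef_pV2 ?posrE ?invr_gt0 ?exprn_gt0.
    have [n /andP[n1 n2]] := geometric_bracket b_gt1 l1; exists n; right; split.
      by rewrite /= in_itv/= n1.
    rewrite lee_fin; apply: ler_pM; rewrite ?powR_ge0 ?invr_ge0 ?(ltW l0)//.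
      rewrite ge0_ler_powR ?nnegrE//; last exact: lacunary_scaled_K_large.
      by rewrite divr_ge0 ?exprn_ge0// ltW.
    by rewrite lef_pV2 ?posrE ?exprn_gt0.
(* For q infinite, boundedness of the weights by 1 suffices; the range lambda >= 1 contributes only
   2 <= 3 B. *)
- exists (3 * B) => lam l0.
  have -> : ((lam `^ (- theta))%:E * Kfun lam f = (lam `^ (- theta) * fine (Kfun lam f))%:E)%E.
    rewrite EFinM fineK//; have := Kfun_lacunary_le2 (ltW l0).
    have := Kfun_ge0 f (ltW l0); case: (Kfun lam f) => //.
  rewrite lee_fin; have [l1|l1] := ltP lam 1.
    have [n hn] := small _ l0 l1.
    apply: le_trans (lacunary_scaled_K_small hn) _.
    by rewrite ler_piMr ?weight_le1// mulr_ge0// ltW.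
  apply: le_trans (@lacunary_scaled_K_large lam 0 _) _; first by rewrite expr0.
  by rewrite expr0 divr1; have := B_ge4; lra.
Qed.

End Lacunary.

(** * Choice of the base *)

Section Base.
Context {R : realType}.

(** With b = 4^(1/theta + 1/(1-theta)), raising to the power theta gives 4^(1 + theta/(1-theta)),
    and symmetrically for 1 - theta. Each exponent is at least 1. *)
Lemma exists_lacunary_base (theta : R) : 0 < theta < 1 ->
  exists b B D : R, [/\ 4 <= B, 4 <= D, b = B * D, b `^ theta = B & b `^ (1 - theta) = D].
Proof.
move=> /andP[t0 t1]; have t1' : 0 < 1 - theta by lra.
pose b := (4 : R) `^ (theta^-1 + (1 - theta)^-1).
exists b, (b `^ theta), (b `^ (1 - theta)); split => //.
- rewrite /b -powRrM mulrDl mulVf ?gt_eqF//.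
  rewrite -[leLHS](@powRr1 _ 4)// ler_powR ?ler1n// lerDl mulr_ge0// ?invr_ge0 ltW//.
- rewrite /b -powRrM mulrDl mulVf ?gt_eqF//.
  rewrite -[leLHS](@powRr1 _ 4)// ler_powR ?ler1n// lerDr mulr_ge0// ?invr_ge0 ltW//.
- rewrite -powRD; last by rewrite subrKC oner_eq0.
  by rewrite subrKC powRr1// powR_ge0.
Qed.

End Base.

(** * The test variable *)

Section JointMeasurability.
Context {R : realType} {d : measure_display} {T : measurableType d}.

(* A Caratheodory function is the pointwise limit of its discretizations
   along the grid (1/n)Z. *)
Lemma measurable_continuous_prod (H : R -> T -> R) :
  (forall u, measurable_fun setT (H u)) -> (forall w, continuous (fun u => H u w)) ->
  measurable_fun setT (fun z : R * T => H z.1 z.2).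
Proof.
move=> mH cH.
pose g (n : nat) (u : R) : R := (Num.floor (u * n.+1%:R))%:~R / n.+1%:R.
apply: (@measurable_fun_cvg _ _ _ _ (fun n z => H (g n z.1) z.2)); last first.
  move=> [u w] _ /=.
  apply: (@cvg_comp _ _ _ (g ^~ u) (fun u => H u w) _ (nbhs u)); last exact: cH.
  apply/cvgrPdist_le => e e0; near=> n.
  have n0 : 0 < n.+1%:R :> R by [].
  have := Num.Theory.floor_le (u * n.+1%:R); have := floorD1_gt (u * n.+1%:R).
  rewrite intrD1; set m := (Num.floor _)%:~R => h1 h2.
  have -> : u - g n u = (u * n.+1%:R - m) / n.+1%:R.
    by rewrite /g -/m mulrBl mulfK// gt_eqF.
  rewrite ger0_norm; last by rewrite divr_ge0 ?subr_ge0// ltW.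
  apply: (@le_trans _ _ (n.+1%:R^-1)).
    by rewrite ler_pdivrMr// mulVf ?gt_eqF// lerBlDl ltW.
  near: n; have := @cvg_harmonic R => /cvgr0_norm_le/(_ _ e0).
  by apply: filterS => n; exact: le_trans (ler_norm _).
move=> n _ B mB; rewrite setTI.
have -> : (fun z : R * T => H (g n z.1) z.2) @^-1` B =
    \bigcup_(m : int) ((fun u : R => Num.floor (u * n.+1%:R)) @^-1` [set m] `*`
       (H (m%:~R / n.+1%:R) @^-1` B)).
  apply/seteqP; split=> [[u w] /= hB|[u w] [m _ [/= fm hB]]].
    by exists (Num.floor (u * n.+1%:R)).
  by rewrite /g fm.
apply: countable_bigcupT_measurable; first exact: countableP.
move=> m; apply: measurableX; last by rewrite -[X in measurable X]setTI; exact: mH.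
have -> : (fun u : R => Num.floor (u * n.+1%:R)) @^-1` [set m] =
    `[m%:~R / n.+1%:R, (m + 1)%:~R / n.+1%:R[%classic.
  apply/seteqP; split => u /=; rewrite in_itv/= ler_pdivrMr// ltr_pdivlMr//.
    by move=> <-; rewrite floor_le floorD1_gt.
  by move=> h; apply: floor_def.
exact: measurable_itv.
Unshelve. all: by end_near. Qed.

End JointMeasurability.

Section TestVariable.
Context {R : realType} {d : measure_display} {T : measurableType d}.
Variables (P : probability T R) (W : R -> T -> R).
Hypothesis W_bm : is_brownian P W.
Variables (b : R) (N : nat).
Hypothesis b_ge4 : 4 <= b.

Definition test_var (w : T) : R := \sum_(0 <= j < N) weight j * cos (b ^+ j * W 1 w).

Lemma W1_measurable : measurable_fun setT (W 1).
Proof. by apply: (brownian_measurable W_bm); rewrite ler01 lexx. Qed.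

Lemma test_var_measurable : measurable_fun setT test_var.
Proof.
apply: measurable_sum => j; apply: measurable_funM => //.
exact: measurableT_comp (measurable_cosM _) W1_measurable.
Qed.

Lemma test_var_bound w : `|test_var w| <= N%:R.
Proof.
apply: le_trans (ler_norm_sum _ _ _) _.
apply: (@le_trans _ _ (\sum_(0 <= j < N) 1)); last by rewrite sumr_const_nat subn0.
apply: ler_sum => j _; rewrite normrM ger0_norm ?weight_ge0// mulr_ile1 ?weight_ge0//.
  exact: weight_le1.
exact: cos_norm_le1.
Qed.

(** The frequencies are so far apart that their difference is at least 3 * 4^(j-1) when i < j, and
    the Gaussian factor is then below 4^(-(j-1)). The bound is stated in product form to make the
    double sum over i and j factorise. *)
Lemma gaussian_offdiag_le i j : i != j ->
  expR (- ((b ^+ i - b ^+ j) ^+ 2 * 1 / 2)) <= 4 * (2^-1 ^+ i * 2^-1 ^+ j).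
Proof.
wlog ij : i j / (i < j)%N.
  move=> H; rewrite neq_ltn => /orP[ij|ji].
    by apply: H => //; rewrite neq_ltn ij.
  rewrite -sqrrN opprB (mulrC (2^-1 ^+ i)); apply: H => //.
  by rewrite neq_ltn ji.
move=> _; rewrite mulr1 expRN.
case: j ij => // j; rewrite ltnS => ij.
have gap : 3 * 4 ^+ j <= b ^+ j.+1 - b ^+ i.
  have bi : b ^+ i <= b ^+ j.
    by rewrite ler_weXn2l//; have := b_ge4; lra.
  have bj : 4 ^+ j <= b ^+ j by rewrite lerXn2r ?nnegrE//; apply: le_trans b_ge4.
  have : 4 * b ^+ j <= b * b ^+ j.
    by rewrite ler_wpM2r// exprn_ge0// (le_trans _ b_ge4).
  rewrite exprS; lra.
have p4 : 0 < (4 : R) ^+ j by rewrite exprn_gt0.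
have p41 : 1 <= (4 : R) ^+ j by rewrite exprn_ege1// ler1n.
have sq : (3 * 4 ^+ j) ^+ 2 <= (b ^+ i - b ^+ j.+1) ^+ 2.
  by rewrite -(sqrrN (b ^+ i - _)) opprB lerXn2r ?nnegrE//; nra.
have le1 : 4 ^+ j <= expR ((b ^+ i - b ^+ j.+1) ^+ 2 / 2).
  by apply: le_trans (expR_ge1Dx _); nra.
apply: (@le_trans _ _ (4^-1 ^+ j)).
  by rewrite exprVn lef_pV2 ?posrE ?expR_gt0.
have -> : (4^-1 : R) ^+ j = 2^-1 ^+ j * 2^-1 ^+ j.
  by rewrite -exprMn; congr (_ ^+ _); field.
rewrite exprS.
have q0 : 0 <= (2^-1 : R) ^+ j by rewrite exprn_ge0// invr_ge0.
have : (2^-1 : R) ^+ j <= 2^-1 ^+ i.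
  by rewrite ler_wiXn2l ?invr_ge0// invf_le1// ler1n.
nra.
Qed.

Lemma sum_half_le n : \sum_(0 <= k < n) (2^-1 : R) ^+ k <= 2.
Proof.
suff : \sum_(0 <= k < n) (2^-1 : R) ^+ k = 2 - 2 * 2^-1 ^+ n.
  by move=> ->; rewrite gerBl mulr_ge0// exprn_ge0// invr_ge0.
elim: n => [|n IH]; first by rewrite big_geq// expr0 mulr1 subrr.
by rewrite big_nat_recr//= IH exprS; field.
Qed.

Lemma cos_product_integrable i j : P.-integrable setT
  (EFin \o (fun w => cos (b ^+ i * W 1 w) * cos (b ^+ j * W 1 w))).
Proof.
apply: (@bounded_expectation_integrable _ _ _ _ _ 1) => [|w].
  by apply: measurable_funM; exact: measurableT_comp (measurable_cosM _) W1_measurable.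
by rewrite normrM mulr_ile1// cos_norm_le1.
Qed.

Lemma Rintegral_sum_nat (F : nat -> T -> R) n :
  (forall k, P.-integrable setT (EFin \o F k)) ->
  \int[P]_w (\sum_(0 <= k < n) F k w) = \sum_(0 <= k < n) \int[P]_w F k w.
Proof.
move=> iF; have iS m : P.-integrable setT (EFin \o (fun w => \sum_(0 <= k < m) F k w)).
  rewrite (_ : _ \o _ = fun w => (\sum_(0 <= k < m) (F k w)%:E)%E).
    by apply: integrable_sum => // k _; exact: iF.
  by apply/funext => w /=; rewrite sumEFin.
elim: n => [|n IH].
  under eq_Rintegral do rewrite big_geq//.
  by rewrite big_geq// expectation_cst.
under eq_Rintegral do rewrite big_nat_recr//=.
by rewrite RintegralD// IH big_nat_recr.
Qed.

Lemma expectation_test_var_sqr :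
  \int[P]_w (test_var w ^+ 2) <= \sum_(0 <= j < N) weight j ^+ 2 + 16.
Proof.
pose F i j w : R := weight i * weight j * (cos (b ^+ i * W 1 w) * cos (b ^+ j * W 1 w)).
have iF i j : P.-integrable setT (EFin \o F i j).
  rewrite /F /comp; under eq_fun do rewrite EFinM.
  by apply: integrableZl => //; exact: cos_product_integrable.
have E : \int[P]_w (test_var w ^+ 2) =
    \sum_(0 <= i < N) \sum_(0 <= j < N) \int[P]_w F i j w.
  transitivity (\int[P]_w (\sum_(0 <= i < N) \sum_(0 <= j < N) F i j w)).
    apply: eq_Rintegral => w _; rewrite expr2 /test_var mulr_suml.
    apply: eq_bigr => i _; rewrite mulr_sumr; apply: eq_bigr => j _.
    by rewrite /F; ring.
  rewrite Rintegral_sum_nat; last first.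
    move=> i; rewrite (_ : _ \o _ = fun w => (\sum_(0 <= j < N) (F i j w)%:E)%E).
      by apply: integrable_sum => // j _; exact: iF.
    by apply/funext => w /=; rewrite sumEFin.
  by apply: eq_bigr => i _; exact: Rintegral_sum_nat.
have Fle i j : \int[P]_w F i j w <=
    (i == j)%:R * weight i ^+ 2 + 4 * (2^-1 ^+ i * 2^-1 ^+ j).
  rewrite /F RintegralZl//; last exact: cos_product_integrable.
  rewrite (expectation_cos_cos W_bm); last by rewrite ler01 lexx.
  have h0 k : 0 <= (2^-1 : R) ^+ k by rewrite exprn_ge0// invr_ge0.
  have ww : 0 <= weight i * weight j :> R by rewrite mulr_ge0 ?weight_ge0.
  have ww1 : weight i * weight j <= 1 :> R.
    by rewrite mulr_ile1 ?weight_ge0 ?weight_le1.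
  have bb k : 0 <= b ^+ k by rewrite exprn_ge0//; have := b_ge4; lra.
  have plus : expR (- ((b ^+ i + b ^+ j) ^+ 2 * 1 / 2)) <=
      expR (- ((b ^+ i - b ^+ j) ^+ 2 * 1 / 2)).
    by rewrite ler_expR; have := bb i; have := bb j; nra.
  have [ij|ij] := eqVneq i j.
    subst j; rewrite mul1r expr2.
    rewrite subrr expr0n/= !mul0r oppr0 expR0 in plus *.
    apply: (@le_trans _ _ (weight i * weight i)).
      by rewrite ler_piMr ?mulr_ge0 ?weight_ge0//; lra.
    by rewrite lerDl !mulr_ge0.
  rewrite mul0r add0r; have := gaussian_offdiag_le ij.
  set x := expR (- ((_ - _) ^+ 2 * 1 / 2)) in plus *.
  set y := expR (- ((b ^+ i + b ^+ j) ^+ 2 * 1 / 2)) in plus * => yz.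
  have x0 : 0 <= x by exact: expR_ge0.
  have y0 : 0 <= y by exact: expR_ge0.
  apply: le_trans yz; apply: (@le_trans _ _ ((x + y) / 2)); last by lra.
  by rewrite ler_piMl//; lra.
rewrite E; apply: (@le_trans _ _ (\sum_(0 <= i < N) \sum_(0 <= j < N)
    ((i == j)%:R * weight i ^+ 2 + 4 * (2^-1 ^+ i * 2^-1 ^+ j)))).
  by apply: ler_sum => i _; apply: ler_sum => j _; exact: Fle.
under eq_bigr do rewrite big_split/=.
rewrite big_split/=; apply: lerD.
  rewrite big_nat_cond [leRHS]big_nat_cond; apply: ler_sum => i /andP[/andP[_ iN] _].
  rewrite -mulr_suml ler_piMl ?sqr_ge0//.
  rewrite (bigD1_seq i) ?mem_index_iota ?iota_uniq//= eqxx.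
  by rewrite big1 ?addr0// => j ji; rewrite eq_sym (negbTE ji).
(* The off-diagonal part is now 4 times the square of a geometric sum that is at most 2; this is the
   origin of 16. *)
under eq_bigr do under eq_bigr do rewrite mulrA.
under eq_bigr do rewrite -mulr_sumr.
rewrite -mulr_suml -mulr_sumr.
have := sum_half_le N; have : 0 <= \sum_(0 <= k < N) (2^-1 : R) ^+ k.
  by apply: sumr_ge0 => k _; rewrite exprn_ge0// invr_ge0.
nra.
Qed.

End TestVariable.

(** * Correlation of the gradient with the test variable *)

Section GradientTest.
Context {R : realType} {d : measure_display} {T : measurableType d}.
Variables (P : probability T R) (W : R -> T -> R).
Hypothesis W_bm : is_brownian P W.
Variables (b B D : R).
Hypotheses (B_ge4 : 4 <= B) (D_ge4 : 4 <= D) (bBD : b = B * D).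
Implicit Types (s t : R) (j k n N : nat).

Let f := lacunary B b.

Definition grad_coef B b k s : R :=
  lacunary_coef B k * expR (- ((b ^+ k) ^+ 2 * (1 - s) / 2)) * b ^+ k.

Let cf := grad_coef B b.

Let b_ge4 : 4 <= b.
Proof. by rewrite bBD; have := B_ge4; have := D_ge4; nra. Qed.

Let bk_ge1 k : 1 <= b ^+ k.
Proof. by rewrite exprn_ege1//; have := b_ge4; lra. Qed.

Let cf_ge0 k s : 0 <= cf k s.
Proof.
apply: mulr_ge0; last exact: le_trans ler01 (bk_ge1 k).
by apply: mulr_ge0; [exact: lacunary_coef_ge0 B_ge4 k|exact: expR_ge0].
Qed.

Lemma phi_lacunary s w : 0 <= s < 1 ->
  phi P W f s w = limn (series (fun k => cf k s * cos (b ^+ k * W s w))).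
Proof.
move=> s01.
exact: (phi_sin_series W_bm w bk_ge1 (lacunary_coef_le B_ge4) s01).
Qed.

(** Uniformity over all s <= t is the point: it yields one bound for the whole path of the gradient
    up to t, needed to integrate it against the kernel. *)
Lemma grad_coef_bound k s t : s <= t -> t < 1 -> `|cf k s| <= 2 / (1 - t) * 4^-1 ^+ k.
Proof.
move=> st t1; have s1 : s < 1 := le_lt_trans st t1.
have H := heat_coef_bound (fun k => b ^+ k) (lacunary_coef_le B_ge4 k) s1.
rewrite /cf /grad_coef normrM (ger0_norm (le_trans ler01 (bk_ge1 k))).
apply: (@le_trans _ _ (1 * (2 / (1 - s)) * 4^-1 ^+ k)).
  apply: le_trans H; rewrite ler_wpM2l// expr2 ler_peMr//.
  exact: le_trans ler01 (bk_ge1 k).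
rewrite mul1r ler_wpM2r ?quarter_ge0// ler_wpM2l//.
by rewrite lef_pV2 ?posrE ?subr_gt0// lerB.
Qed.

Lemma grad_series_dom k s t (x : R) : s <= t -> t < 1 ->
  `|cf k s * cos (b ^+ k * x)| <= 2 / (1 - t) * 4^-1 ^+ k.
Proof.
move=> st t1; rewrite normrM; apply: le_trans (grad_coef_bound k st t1).
by rewrite ler_piMr// cos_norm_le1.
Qed.

Lemma phi_lacunary_bound s t w : 0 <= s -> s <= t -> t < 1 ->
  `|phi P W f s w| <= 2 * (2 / (1 - t)).
Proof.
move=> s0 st t1; rewrite phi_lacunary ?s0 ?(le_lt_trans st)//.
by apply: geom_dom_lim => k; exact: grad_series_dom.
Qed.

(* All the correlations are nonnegative, so only the diagonal is kept. *)
Lemma expectation_phi_test N s : 0 <= s < 1 ->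
  \sum_(0 <= j < N) 2^-1 * (weight j ^+ 2 * D ^+ j * expR (- ((b ^+ j) ^+ 2 * (1 - s)))) <=
  \int[P]_w (phi P W f s w * test_var W b N w).
Proof.
move=> s01; have [s0 s1] := andP s01.
have s01' : 0 <= s <= 1 by rewrite s0 ltW.
pose G := test_var W b N.
have mG : measurable_fun setT G := test_var_measurable W_bm b N.
pose X k w : R := cf k s * cos (b ^+ k * W s w) * G w.
pose Z k j w : R := cf k s * weight j * (cos (b ^+ k * W s w) * cos (b ^+ j * W 1 w)).
have mcos k : measurable_fun setT (fun w => cos (b ^+ k * W s w)).
  exact: measurableT_comp (measurable_cosM _) (brownian_measurable W_bm s01').
have dom k w : `|X k w| <= 2 / (1 - s) * N%:R * 4^-1 ^+ k.
  rewrite /X normrM [leRHS]mulrAC; apply: ler_pM => //.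
    exact: (grad_series_dom _ _ (lexx s) s1).
  exact: test_var_bound.
have -> : \int[P]_w (phi P W f s w * G w) = limn (series (fun k => \int[P]_w X k w)).
  rewrite -(@expectation_series _ _ _ P X (2 / (1 - s) * N%:R))//; last first.
    by move=> k; apply: measurable_funM => //; exact: measurable_funM.
  apply: eq_Rintegral => w _; rewrite phi_lacunary// mulrC.
  have -> : X ^~ w = G w *: (fun k => cf k s * cos (b ^+ k * W s w)).
    by apply/funext => k; rewrite /X fctE /GRing.scale/= mulrC.
  rewrite lim_seriesZ//.
  by apply: geom_dom_cvg => k; exact: (grad_series_dom _ _ (lexx s) s1).
have iC k j : P.-integrable setT
    (EFin \o (fun w => cos (b ^+ k * W s w) * cos (b ^+ j * W 1 w))).
  apply: (@bounded_expectation_integrable _ _ _ _ _ 1) => [|w].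
    apply: measurable_funM => //.
    exact: measurableT_comp (measurable_cosM _) (W1_measurable W_bm).
  by rewrite normrM mulr_ile1// cos_norm_le1.
have iZ k j : P.-integrable setT (EFin \o Z k j).
  by rewrite /Z /comp; under eq_fun do rewrite EFinM; by apply: integrableZl => //; exact: iC.
have XE k : \int[P]_w X k w = \sum_(0 <= j < N) \int[P]_w Z k j w.
  rewrite -Rintegral_sum_nat//; apply: eq_Rintegral => w _.
  rewrite /X /G /test_var mulr_sumr; apply: eq_bigr => j _; rewrite /Z; ring.
have ZE k j : \int[P]_w Z k j w = cf k s * weight j *
    (expR (- ((b ^+ j) ^+ 2 * (1 - s) / 2)) *
    ((expR (- ((b ^+ k - b ^+ j) ^+ 2 * s / 2)) + expR (- ((b ^+ k + b ^+ j) ^+ 2 * s / 2))) / 2)).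
  by rewrite /Z RintegralZl// (expectation_cos_cos1 W_bm).
have Z0 k j : 0 <= \int[P]_w Z k j w.
  rewrite ZE; apply: mulr_ge0; first by rewrite mulr_ge0 ?weight_ge0.
  by rewrite mulr_ge0 ?expR_ge0// divr_ge0// addr_ge0 ?expR_ge0.
have X0 k : 0 <= \int[P]_w X k w by rewrite XE sumr_ge0.
have cX : cvgn (series (fun k => \int[P]_w X k w)).
  apply: (@geom_dom_cvg _ (2 / (1 - s) * N%:R)) => k.
  have mX : measurable_fun setT (X k).
    by apply: measurable_funM => //; exact: measurable_funM.
  apply: le_trans (le_normr_Rintegral measurableT _) _.
    by apply: bounded_expectation_integrable => // w; exact: dom.
  rewrite -[leRHS](expectation_cst P).
  apply: le_Rintegral; [exact: measurableT|..|by move=> w _; exact: dom].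
    apply: (@bounded_expectation_integrable _ _ _ _ _ (2 / (1 - s) * N%:R * 4^-1 ^+ k)).
      exact: measurableT_comp.
    by move=> w; rewrite normr_id; exact: dom.
  exact: (@bounded_expectation_integrable _ _ _ P (cst (2 / (1 - s) * N%:R * 4^-1 ^+ k))
    `|2 / (1 - s) * N%:R * 4^-1 ^+ k| (measurable_cst _) (fun=> lexx _)).
(* The terms are nonnegative, so the series dominates its first N terms, which are the modes that
   have a partner of equal frequency in the test variable. *)
apply: (@le_trans _ _ (series (fun k => \int[P]_w X k w) N)); last first.
  apply: nondecreasing_cvgn_le => //.
  by apply/nondecreasing_seqP => n; rewrite seriesS lerDr.
rewrite /series/= big_nat_cond [leRHS]big_nat_cond.
apply: ler_sum => k /andP[/andP[_ kN] _].
rewrite XE (bigD1_seq k) ?mem_index_iota ?iota_uniq//=.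
apply: (@le_trans _ _ (\int[P]_w Z k k w)); last by rewrite lerDl sumr_ge0.
rewrite ZE subrr expr0n/= !mul0r oppr0 expR0.
set x := expR (- ((b ^+ k + b ^+ k) ^+ 2 * s / 2)).
have x0 : 0 <= x by exact: expR_ge0.
(* Two equal damping factors meet: one from the heat semigroup inside the gradient, one from
   conditioning the cosine of W_1 on time s. The remaining (1 + x)/2 is the second moment of cos(b^k
   W_s), at least 1/2. *)
have -> : - ((b ^+ k) ^+ 2 * (1 - s)) =
    - ((b ^+ k) ^+ 2 * (1 - s) / 2) + - ((b ^+ k) ^+ 2 * (1 - s) / 2) by field.
rewrite expRD /cf /grad_coef /lacunary_coef; set e := expR _.
have -> : weight k / B ^+ k * e * b ^+ k * weight k * (e * ((1 + x) / 2)) =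
    weight k ^+ 2 * D ^+ k * (e * e) * ((1 + x) / 2).
  rewrite bBD exprMn; field.
  by rewrite expf_neq0// gt_eqF// (lt_le_trans _ B_ge4).
rewrite [leLHS]mulrC ler_wpM2l//; last by lra.
have D0 : 0 <= D by apply: le_trans D_ge4.
apply: mulr_ge0; last by apply: mulr_ge0; exact: expR_ge0.
by apply: mulr_ge0; [exact: sqr_ge0|exact: exprn_ge0].
Qed.

End GradientTest.

(** * The fractional integral *)

Section Kernel.
Context {R : realType}.
Variables (theta b B D : R).
Hypotheses (theta01 : 0 < theta < 1) (B_ge4 : 4 <= B) (D_ge4 : 4 <= D)
  (bBD : b = B * D) (D_def : b `^ (1 - theta) = D).
Implicit Types (u x y : R) (j n : nat).

Let alpha := (1 - theta) / 2.
Local Notation leb := (@lebesgue_measure R).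

(** The time to maturity below which mode n is essentially undamped: (b^n)^2 times it equals 1. *)
Definition gap (b : R) n : R := ((b ^+ n) ^+ 2)^-1.

Let b_gt1 : 1 < b.
Proof. by rewrite bBD; have := B_ge4; have := D_ge4; nra. Qed.

Let b_gt0 : 0 < b. Proof. exact: lt_trans b_gt1. Qed.

Let alpha_lt1 : alpha - 1 < 0.
Proof. by rewrite /alpha; have /andP[? ?] := theta01; lra. Qed.

Lemma gap_gt0 n : 0 < gap b n.
Proof. by rewrite invr_gt0 !exprn_gt0. Qed.

Lemma gap_le m n : (m <= n)%N -> gap b n <= gap b m.
Proof.
move=> mn; rewrite lef_pV2 ?posrE ?exprn_gt0// lerXn2r ?nnegrE ?exprn_ge0 ?(ltW b_gt0)//.
by rewrite ler_weXn2l// ltW.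
Qed.

Lemma gap_le1 n : gap b n <= 1.
Proof. by apply: le_trans (gap_le (leq0n n)) _; rewrite /gap !expr1n invr1. Qed.

(** Since 2 alpha = 1 - theta, the power alpha of the gap is b^(-n(1-theta)) = D^(-n); division by
    the gap itself restores b^(2n). *)
Lemma gap_powR n : gap b n `^ (alpha - 1) = (b ^+ n) ^+ 2 / D ^+ n.
Proof.
rewrite powRB; last by rewrite (gt_eqF (gap_gt0 n)) implybT.
rewrite powRr1 ?(ltW (gap_gt0 n))// {2}/gap invrK mulrC; congr (_ * _).
rewrite /gap -powR_invn ?exprn_ge0 ?(ltW b_gt0)// -powRrM /alpha.
have -> : 1 *- 2 * ((1 - theta) / 2) = - (1 - theta) by field.
rewrite powRN; congr (_^-1).
by rewrite -powR_mulrn ?(ltW b_gt0)// powRAC D_def powR_mulrn// (le_trans _ D_ge4).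
Qed.

Lemma powR_neg_le x y : 0 < x -> x <= y -> y `^ (alpha - 1) <= x `^ (alpha - 1).
Proof.
move=> x0 xy; have y0 := lt_le_trans x0 xy.
rewrite -(opprK (alpha - 1)) !(powRN _ (- (alpha - 1))) lef_pV2 ?posrE ?powR_gt0//.
by rewrite ge0_ler_powR ?nnegrE ?(ltW x0) ?(ltW y0)// oppr_ge0 ltW.
Qed.

Lemma measurable_kernel : measurable_fun setT (fun u : R => (1 - u) `^ (alpha - 1)).
Proof.
apply: (@measurableT_comp _ _ _ _ _ _ (fun x : R => x `^ (alpha - 1)) _ (fun u => 1 - u)).
  exact: measurable_powR.
exact: measurable_funB.
Qed.

(** On the slab between consecutive gaps the kernel is at most b^(2n+2) / D^(n+1) and the length at
    most b^(-2n), so the contributions b^2 / D^(n+1) are summable. The second family of the cover is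
    used only for the endpoint 1. *)
Lemma kernel_integral_lty :
  (\int[leb]_(u in `[0%R, 1%R]) ((1 - u) `^ (alpha - 1))%:E < +oo)%E.
Proof.
have b2 : 1 < b ^+ 2 by rewrite exprn_egt1.
apply: (@integral_step_cover_lty _ _ R leb `[0%R, 1%R]%classic _
  (fun n => `[1 - gap b n, 1 - gap b n.+1]%classic) (fun=> `[1%R, 1%R]%classic)
  (fun n => gap b n.+1 `^ (alpha - 1)) (fun=> 0)
  (fun n => b ^+ 2 * 4^-1 ^+ n) (b ^+ 2 * 2)).
- exact: measurable_itv.
- by move=> u _; rewrite lee_fin powR_ge0.
- by move=> n; exact: measurable_itv.
- by move=> n; exact: measurable_itv.
- by move=> n; exact: powR_ge0.
- by [].
- move=> n /=; rewrite mul0e adde0.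
  apply: (@le_trans _ _ ((gap b n.+1 `^ (alpha - 1))%:E * (gap b n)%:E)%E).
    rewrite lee_wpmul2l ?lee_fin ?powR_ge0// lebesgue_measure_itv/=.
    case: ifPn => _; last by rewrite lee_fin ltW ?gap_gt0.
    by rewrite -EFinB lee_fin; have := gap_gt0 n.+1; lra.
  rewrite -EFinM lee_fin gap_powR /gap.
  rewrite [leLHS](_ : _ = b ^+ 2 * (D ^+ n.+1)^-1); last first.
    rewrite (exprS b) (exprMn _ b); field.
    by rewrite !expf_neq0 ?gt_eqF// (lt_le_trans _ D_ge4).
  rewrite ler_wpM2l ?sqr_ge0// exprVn lef_pV2 ?posrE ?exprn_gt0 ?(lt_le_trans _ D_ge4)//.
  have D1 : 1 <= D by apply: le_trans D_ge4; rewrite ler1n.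
  apply: (@le_trans _ _ (D ^+ n)); last by rewrite ler_weXn2l.
  by rewrite lerXn2r ?nnegrE// (le_trans _ D_ge4).
- move=> n; rewrite /series/= -mulr_sumr ler_wpM2l ?sqr_ge0//.
  by have := @sum_quarter_lt R 0 n; rewrite expr0 mulr1.
- move=> u /=; rewrite in_itv/= => /andP[u0]; rewrite le_eqVlt => /orP[/eqP ->|u1].
    (* At u = 1 the kernel is a negative power of 0, which [powR] evaluates to 0. *)
    exists 0%N; right; split; first by rewrite /= in_itv/= lexx.
    by rewrite subrr powR0// lt_eqF.
  have u1' : 0 < 1 - u by rewrite subr_gt0.
  have [|n /andP[n1 n2]] := @geometric_bracket R (b ^+ 2) (1 - u)^-1 b2.
    by rewrite invf_ge1//; lra.
  have gE m : gap b m = ((b ^+ 2) ^+ m)^-1 by rewrite /gap -!exprM mulnC.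
  have g1 : gap b n.+1 <= 1 - u.
    by rewrite gE -[leRHS]invrK lef_pV2 ?posrE ?invr_gt0 ?exprn_gt0.
  have g2 : 1 - u <= gap b n.
    by rewrite gE -[leLHS]invrK lef_pV2 ?posrE ?invr_gt0 ?exprn_gt0.
  exists n; left; split; first by rewrite /= in_itv/=; apply/andP; split; lra.
  by rewrite lee_fin powR_neg_le// gap_gt0.
Qed.

Lemma kernel_integrable :
  leb.-integrable `[0%R, 1%R] (fun u => ((1 - u) `^ (alpha - 1))%:E).
Proof.
apply/integrableP; split.
  by apply: measurable_funTS; apply/measurable_EFinP; exact: measurable_kernel.
under eq_integral do rewrite gee0_abs ?lee_fin ?powR_ge0//.
exact: kernel_integral_lty.
Qed.

End Kernel.

(** * Exchange of the time integral and the expectation *)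

Section Fractional.
Context {R : realType} {d : measure_display} {T : measurableType d}.
Variables (P : probability T R) (W : R -> T -> R).
Hypothesis W_bm : is_brownian P W.
Variables (theta b B D : R).
Hypotheses (theta01 : 0 < theta < 1) (B_ge4 : 4 <= B) (D_ge4 : 4 <= D)
  (bBD : b = B * D) (D_def : b `^ (1 - theta) = D).
Implicit Types (s t u : R) (j k n N : nat).

Let f := lacunary B b.
Let alpha := (1 - theta) / 2.
Local Notation leb := (@lebesgue_measure R).

(** A total version of min(u, t) with values in [0, t] for t >= 0. Path continuity is given only
    within [0, 1], whereas joint measurability is proved for functions continuous in u on the whole
    line. *)
Definition clamp t u : R := Num.max 0 (Num.min u t).

Lemma clamp_itv t u : 0 <= t -> 0 <= clamp t u <= t.
Proof. by move=> t0; rewrite /clamp le_max lexx/= ge_max t0 ge_min lexx orbT. Qed.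

Lemma clamp_min t u : 0 <= t -> 0 <= u -> clamp t u = Num.min u t.
Proof. by move=> t0 u0; rewrite /clamp max_r// le_min u0 t0. Qed.

Lemma clamp_continuous t : continuous (clamp t).
Proof.
move=> u; apply: (@continuous_max R _ (cst 0) (fun u => Num.min u t) u).
  exact: cvg_cst.
by apply: (@continuous_min R _ id (cst t) u); [exact: cvg_id|exact: cvg_cst].
Qed.

Lemma brownian_clamp_continuous t w : 0 <= t -> t < 1 ->
  continuous (fun u => W (clamp t u) w).
Proof.
move=> t0 t1 u.
have [_ [_ [cW _]]] := W_bm.
have c01 v : `[0, 1]%classic (clamp t v).
  have /andP[h1 h2] := clamp_itv v t0.
  by rewrite /= in_itv/= h1 (le_trans h2 (ltW t1)).
have /subspace_continuousP/(_ _ (c01 u)) := cW w.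
move=> cWu A /cWu AW.
have H : nbhs u (fun v => `[0, 1]%classic (clamp t v) -> A (W (clamp t v) w)).
  exact: (@clamp_continuous t u _ AW).
exact: (filterS (fun v h => h (c01 v)) H).
Qed.

(** The gradient is a pointwise limit of finite sums in the time and in W at that time; W is jointly
    measurable because its paths are continuous. *)
Lemma phi_clamp_measurable t : 0 <= t -> t < 1 ->
  measurable_fun setT (fun z : R * T => phi P W f (clamp t z.1) z.2).
Proof.
move=> t0 t1.
have c01 u : 0 <= clamp t u < 1.
  by have /andP[h1 h2] := clamp_itv u t0; rewrite h1 (le_lt_trans h2 t1).
have mW : measurable_fun setT (fun z : R * T => W (clamp t z.1) z.2).
  apply: (@measurable_continuous_prod _ _ _ (fun u w => W (clamp t u) w)).
    move=> u; apply: (brownian_measurable W_bm).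
    by have /andP[-> /ltW ->] := c01 u.
  by move=> w; exact: brownian_clamp_continuous.
apply: (@measurable_fun_cvg _ _ _ _ (fun n z => series (fun k =>
    grad_coef B b k (clamp t z.1) * cos (b ^+ k * W (clamp t z.1) z.2)) n)).
  move=> n; apply: measurable_sum => k; apply: measurable_funM.
    apply: (@measurableT_comp _ _ _ _ _ _ (fun u => grad_coef B b k (clamp t u))).
      apply: continuous_measurable_fun => u.
      apply: (@continuous_comp _ _ _ (clamp t) (grad_coef B b k)).
        exact: clamp_continuous.
      apply: cvgM; last exact: cvg_cst.
      apply: cvgM; first exact: cvg_cst.
      apply: (@cvg_comp _ _ _ (fun s => - ((b ^+ k) ^+ 2 * (1 - s) / 2)) expR _
        (nbhs (- ((b ^+ k) ^+ 2 * (1 - clamp t u) / 2)))); last exact: continuous_expR.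
      apply: cvgN; apply: cvgM; last exact: cvg_cst.
      apply: cvgM; first exact: cvg_cst.
      by apply: cvgB; [exact: cvg_cst|exact: cvg_id].
    exact: measurable_fst.
  exact: (measurableT_comp (measurable_cosM (b ^+ k)) mW).
move=> [u w] _ /=; rewrite (phi_lacunary W_bm B_ge4 D_ge4 bBD w (c01 u)).
apply: (@geom_dom_cvg _ (2 / (1 - clamp t u))) => k.
apply: (grad_series_dom B_ge4 D_ge4 bBD k _ (lexx _)).
by have /andP[] := c01 u.
Qed.

Definition frac_kernel t w : R :=
  \int[leb]_(u in `[0, 1]) ((1 - u) `^ (alpha - 1) * phi P W f (Num.min u t) w).

Lemma frac_kernelE t w : frac_I alpha (phi P W f) t w = alpha * frac_kernel t w.
Proof. by []. Qed.

(** Extension by zero turns the time integral into one over the whole line, so that Fubini applies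
    on the full product space. *)
Definition kernel01 u : R := ((fun u => (1 - u) `^ (alpha - 1)) \_ `[0, 1]) u.

Lemma kernel01_ge0 u : 0 <= kernel01 u.
Proof. by rewrite /kernel01 patchE; case: ifPn => // _; exact: powR_ge0. Qed.

Lemma kernel01_measurable : measurable_fun setT kernel01.
Proof.
apply/(measurable_restrictT _ (measurable_itv _)); apply: measurable_funTS.
exact: measurable_kernel.
Qed.

Lemma kernel01_integrable : leb.-integrable setT (fun u => (kernel01 u)%:E).
Proof.
have m01 : measurable (`[0, 1]%classic : set (measurableTypeR R)).
  exact: measurable_itv.
have := (integrable_mkcond _ m01).1
  (kernel_integrable theta01 B_ge4 D_ge4 bBD D_def).
by apply: eq_integrable => // u _; rewrite restrict_EFin.
Qed.

Let C t : R := 2 * (2 / (1 - t)).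

Lemma fractional_Fubini t (G : T -> R) (M : R) : 0 <= t -> t < 1 ->
  measurable_fun setT G -> (forall w, `|G w| <= M) ->
  [/\ (forall w, `|frac_kernel t w| <= C t * \int[leb]_u kernel01 u),
      measurable_fun setT (fun u => kernel01 u * \int[P]_w (phi P W f (clamp t u) w * G w)) &
      (\int[P]_w (frac_kernel t w * G w)%:E =
       \int[leb]_u (kernel01 u * \int[P]_w (phi P W f (clamp t u) w * G w))%:E)%E].
Proof.
move=> t0 t1 mG GM.
have c01 u : 0 <= clamp t u < 1.
  by have /andP[h1 h2] := clamp_itv u t0; rewrite h1 (le_lt_trans h2 t1).
pose ps u w := phi P W f (clamp t u) w.
have psC u w : `|ps u w| <= C t.
  have /andP[h1 h2] := clamp_itv u t0.
  exact: (phi_lacunary_bound W_bm B_ge4 D_ge4 bBD w h1 h2 t1).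
have C0 : 0 <= C t by apply: le_trans (psC 0 point).
have M0 : 0 <= M by apply: le_trans (GM point).
pose K (z : measurableTypeR R * T) : \bar R := (kernel01 z.1 * (ps z.1 z.2 * G z.2))%:E.
have mps : measurable_fun setT (fun z : measurableTypeR R * T => ps z.1 z.2).
  exact: phi_clamp_measurable t0 t1.
have mK : measurable_fun setT K.
  apply/measurable_EFinP; apply: measurable_funM.
    apply: (@measurableT_comp _ _ _ _ _ _ kernel01); first exact: kernel01_measurable.
    exact: measurable_fst.
  apply: measurable_funM => //.
  by apply: measurableT_comp; [exact: mG|exact: measurable_snd].
have KC u w : (`|K (u, w)| <= (C t * M)%:E * (kernel01 u)%:E)%E.
  rewrite /K/= -EFinM lee_fin normrM (ger0_norm (kernel01_ge0 u)) mulrC.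
  by rewrite ler_wpM2r ?kernel01_ge0// normrM ler_pM.
have iK : (leb \x P)%E.-integrable setT K.
  apply/(integrable12ltyP leb P mK).
  apply: (@le_lt_trans _ _ (\int[leb]_u ((C t * M)%:E * (kernel01 u)%:E))%E).
    apply: le_integral_nonmeasurable => u _; first exact: integral_ge0.
    apply: (@le_trans _ _ (\int[P]_w ((C t * M)%:E * (kernel01 u)%:E))%E).
      by apply: le_integral_nonmeasurable => w _; [exact: abse_ge0|exact: KC].
    rewrite integral_cst//.
    by have /= -> := @probability_setT _ _ _ P; rewrite mule1.
  have := integrableZl measurableT (C t * M) kernel01_integrable.
  by move=> /integrable_lty; apply.
have mpsu u : measurable_fun setT (ps u).
  by have := measurableT_comp mps (pair1_measurable u).
have ips u : P.-integrable setT (EFin \o (fun w => ps u w * G w)).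
  apply: (@bounded_expectation_integrable _ _ _ _ _ (C t * M)).
    exact: (measurable_funM (mpsu u) mG).
  by move=> w; rewrite normrM ler_pM.
have EK u : (\int[P]_w K (u, w) =
    (kernel01 u * \int[P]_w (phi P W f (clamp t u) w * G w))%:E)%E.
  rewrite /K/=; under eq_integral do rewrite EFinM.
  rewrite (integralZl measurableT (ips u)) /Rintegral [RHS]EFinM.
  by rewrite fineK//; exact: integrable_fin_num (ips u).
have ikp w : leb.-integrable setT (EFin \o (fun u => kernel01 u * ps u w)).
  apply: (@le_integrable _ _ _ leb setT measurableT _ (fun u => ((C t)%:E * (kernel01 u)%:E)%E)).
  - apply/measurable_EFinP/measurable_funM; first exact: kernel01_measurable.
    by have := measurableT_comp mps (pair2_measurable w).
  - move=> u _; rewrite -EFinM lee_fin (ger0_norm (mulr_ge0 C0 (kernel01_ge0 u))) normrM.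
    by rewrite (ger0_norm (kernel01_ge0 u)) mulrC ler_wpM2r ?kernel01_ge0.
  - exact: (integrableZl measurableT (C t) kernel01_integrable).
have fkE w : frac_kernel t w = \int[leb]_u (kernel01 u * ps u w).
  rewrite /frac_kernel Rintegral_mkcond; apply: eq_Rintegral => u _.
  rewrite /kernel01 !patchE; case: ifPn; last by rewrite mul0r.
  by rewrite inE/= in_itv/= => /andP[u0 _]; rewrite /ps clamp_min.
split.
- move=> w; rewrite fkE.
  apply: le_trans (le_normr_Rintegral measurableT (ikp w)) _.
  rewrite -RintegralZl//; last exact: kernel01_integrable.
  apply: le_Rintegral => //.
  + exact: (integrable_norm (ikp w)).
  + exact: (integrableZl measurableT (C t) kernel01_integrable).
  + move=> u _; rewrite normrM (ger0_norm (kernel01_ge0 u)) mulrC.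
    by rewrite ler_wpM2r ?kernel01_ge0.
- apply/measurable_EFinP.
  have := @measurable_fubini_F _ _ _ _ _ leb P K iK.
  by congr (measurable_fun setT _); apply/funext => u; rewrite /fubini_F EK.
- under [RHS]eq_integral do rewrite -EK.
  rewrite Fubini//; apply: eq_integral => w _.
  rewrite fkE /K/= [LHS]EFinM [LHS]muleC.
  transitivity (\int[leb]_u ((G w)%:E * (kernel01 u * ps u w)%:E))%E; last first.
    by apply: eq_integral => u _; rewrite -EFinM; congr EFin; ring.
  rewrite integralZl//; last exact: ikp.
  by congr (_ * _)%E; rewrite /Rintegral fineK//; exact: integrable_fin_num (ikp w).
Qed.

End Fractional.

(** * The lower bound *)

Section LowerBound.
Context {R : realType} {d : measure_display} {T : measurableType d}.
Variables (P : probability T R) (W : R -> T -> R).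
Hypothesis W_bm : is_brownian P W.
Variables (theta b B D : R).
Hypotheses (theta01 : 0 < theta < 1) (B_ge4 : 4 <= B) (D_ge4 : 4 <= D)
  (bBD : b = B * D) (D_def : b `^ (1 - theta) = D).

Local Notation leb := (@lebesgue_measure R).

(** After Fubini the time integrand is bounded below by a sum of N step functions on the nested
    intervals [1 - gap_j, 1). Each of them integrates to the j-th summand on the left, the powers of
    [D] having cancelled. *)
Lemma frac_kernel_test (N : nat) :
  ((expR (-1) / 2 * \sum_(0 <= j < N) weight j ^+ 2)%:E <=
   \int[P]_w (frac_kernel P W theta b B (1 - gap b N) w * test_var W b N w)%:E)%E.
Proof.
have D0 : 0 < D by apply: lt_le_trans D_ge4.
have b0 : 0 < b by rewrite bBD mulr_gt0// (lt_le_trans _ B_ge4).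
have g0 j : 0 < gap b j by exact: gap_gt0 B_ge4 D_ge4 bBD j.
have g1 j : gap b j <= 1 by exact: gap_le1 B_ge4 D_ge4 bBD j.
set t := 1 - gap b N.
have t0 : 0 <= t by rewrite subr_ge0.
have t1 : t < 1 by rewrite /t; have := g0 N; lra.
have [_ mKm ->] := fractional_Fubini W_bm theta01 B_ge4 D_ge4 bBD D_def t0 t1
  (test_var_measurable W_bm b N) (test_var_bound W b N).
set m := fun u => \int[P]_w (phi P W (lacunary B b) (clamp t u) w * test_var W b N w).
pose k j : R := gap b j `^ ((1 - theta) / 2 - 1).
pose I j : set R := `[1 - gap b j, 1[%classic.
(* Height of the j-th step: on [I j] the kernel is at least [k j], and the j-th correlation term is
   at least the other factor. Multiplied by the length gap_j, [k j] becomes D^(-j). *)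
pose c j : R := 2^-1 * (weight j ^+ 2 * D ^+ j * expR (-1)) * k j.
have k0 j : 0 <= k j by exact: powR_ge0.
have wD j : 0 <= weight j ^+ 2 * D ^+ j.
  by apply: mulr_ge0; [exact: sqr_ge0|apply: exprn_ge0; exact: ltW].
have c0 j : 0 <= c j.
  apply: mulr_ge0 => //; apply: mulr_ge0; first by rewrite invr_ge0.
  by apply: mulr_ge0; [exact: wD|exact: expR_ge0].
have mI j : measurable (I j : set (measurableTypeR R)) by exact: measurable_itv.
pose F j u := (c j * \1_(I j) u)%:E.
have mF j : measurable_fun setT (F j : measurableTypeR R -> \bar R).
  by apply/measurable_EFinP; apply: measurable_funM => //; exact: measurable_indic.
have F0 j u : (0 <= F j u)%E by rewrite lee_fin mulr_ge0.
have -> : ((expR (-1) / 2 * \sum_(0 <= j < N) weight j ^+ 2)%:E =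
    \int[leb]_u (\sum_(0 <= j < N) F j u))%E.
  rewrite ge0_integral_sum//.
  rewrite mulr_sumr -sumEFin; apply: eq_bigr => j _.
  rewrite /F; under eq_integral do rewrite EFinM.
  rewrite ge0_integralZl_EFin//; last by apply/measurable_EFinP; exact: measurable_indic.
  have -> : (\int[leb]_u (\1_(I j) u)%:E = (gap b j)%:E)%E.
    rewrite integral_indic// setIT /I/= lebesgue_measure_itv/= lte_fin.
    have -> : 1 - gap b j < 1 by have := g0 j; lra.
    by rewrite -EFinB; congr EFin; ring.
  rewrite -EFinM; congr EFin.
  rewrite /c /k (gap_powR B_ge4 D_ge4 bBD D_def) /gap; field.
  by rewrite !expf_neq0// gt_eqF.
apply: ge0_le_integral => //.
- by move=> u _; rewrite sume_ge0.
- by apply: emeasurable_sum => j _; exact: mF.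
- exact/measurable_EFinP.
move=> u _; rewrite /F sumEFin lee_fin.
have cl := clamp_itv u t0; have /andP[cl0 clt] := cl.
have cl1 : 0 <= clamp t u < 1 by rewrite cl0 (le_lt_trans clt t1).
have mu := expectation_phi_test W_bm B_ge4 D_ge4 bBD N cl1.
apply: le_trans (ler_wpM2l (kernel01_ge0 theta u) mu).
rewrite mulr_sumr big_nat_cond [leRHS]big_nat_cond.
apply: ler_sum => j /andP[/andP[_ jN] _].
have r0 : 0 <= kernel01 theta u * (2^-1 * (weight j ^+ 2 * D ^+ j *
    expR (- (b ^+ j ^+ 2 * (1 - clamp t u))))).
  apply: mulr_ge0; first exact: kernel01_ge0.
  apply: mulr_ge0; first by rewrite invr_ge0.
  by apply: mulr_ge0; [exact: wD|exact: expR_ge0].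
rewrite indicE; case: (boolP (u \in I j)) => uI; last by rewrite mulr0.
rewrite mulr1 /c mulrC; move: uI; rewrite inE /I/= in_itv/= => /andP[ju u1].
have u0 : 0 <= u by have := g1 j; lra.
have kk : k j <= kernel01 theta u.
  rewrite /kernel01 patchE mem_set/=; last by rewrite in_itv/= u0 ltW.
  by apply: (powR_neg_le theta01); lra.
apply: ler_pM => //.
  by apply: mulr_ge0; [rewrite invr_ge0|apply: mulr_ge0; [exact: wD|exact: expR_ge0]].
rewrite ler_wpM2l ?invr_ge0// ler_wpM2l// ler_expR lerN2.
(* Here j < N is essential: freezing at t = 1 - gap_N does not push the time below 1 - gap_j, so the
   damping exponent is at most 1. *)
have cj : 1 - gap b j <= clamp t u.
  rewrite clamp_min// le_min ju /t/= lerB//.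
  exact: gap_le B_ge4 D_ge4 bBD _ _ (ltnW jN).
apply: (@le_trans _ _ (b ^+ j ^+ 2 * gap b j)).
  by rewrite ler_wpM2l ?sqr_ge0//; lra.
by rewrite /gap divff// !expf_neq0// gt_eqF.
Qed.

End LowerBound.

(** * From the BMO condition to a uniform second moment *)

Section BMO.
Context {R : realType} {d : measure_display} {T : measurableType d}.
Variable P : probability T R.

(** Taking a = 0 and integrating the conditional expectation over the whole space gives
    E[sup_t (Y_t - Y_0)^2] <= c, because the left value at 0 is Y_0 by convention. *)
Lemma BMO2_L2_bound (Fs : R -> set (set T)) (Y : R -> T -> R) :
  Fs 0 setT -> (forall A, Fs 0 A -> measurable A) -> in_BMO2 P Fs Y ->
  exists c : R, forall t, 0 <= t < 1 ->
    (\int[P]_w ((Y t w - Y 0 w) ^+ 2)%:E <= c%:E)%E.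
Proof.
move=> FT FM [_ [_ [_ [_ [c Hc]]]]]; exists c => t t01.
have [Z [[Z0 [ZF Zint]] Zc]] := Hc 0 (introT andP (conj (lexx 0) ltr01)).
have mZ : measurable_fun setT Z.
  by move=> _ A mA; rewrite setTI; exact/FM/ZF.
have c0 : (0 <= c%:E)%E.
  (* An almost sure event is nonempty under a probability, so [c] inherits nonnegativity from
     [Z]. *)
  have [w Zw] : exists w, (Z w <= c%:E)%E.
    apply/not_existsP => H; have := Zc => -[N [mN N0 sN]].
    have NT : N = setT by apply/seteqP; split => // w _; apply: sN => /=; exact: H.
    move: N0; rewrite NT; have /= -> := @probability_setT _ _ _ P.
    by move/eqP; rewrite onee_eq0.
  exact: le_trans (Z0 w) Zw.
apply: (@le_trans _ _ (\int[P]_w bmo_sup Y 0 w)%E).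
  apply: le_integral_nonmeasurable => w _; first by rewrite lee_fin sqr_ge0.
  apply: ereal_sup_ubound; exists t; first by rewrite /= in_itv.
  by rewrite /left_val eqxx.
rewrite -(Zint _ FT).
apply: (@le_trans _ _ (\int[P]_w cst c%:E w)%E).
  by apply: ae_ge0_le_integral => //; apply: filterS Zc => w h _.
rewrite integral_cst//.
by have /= -> := @probability_setT _ _ _ P; rewrite mule1.
Qed.

(** The shift by a deterministic constant drops out of Y_t - Y_0. Measurability of [J t] is read off
    from the BMO hypothesis, so it need not be established for the fractional integral
    separately. *)
Lemma BMO2_shift_L2_bound (Fs : R -> set (set T)) (J : R -> T -> R) (p : T -> R)
    (p0 k0 : R) :
  Fs 0 setT -> (forall A, Fs 0 A -> measurable A) ->
  (forall w, p w = p0) -> (forall w, J 0 w = k0) ->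
  in_BMO2 P Fs (fun t w => J t w - p w) ->
  exists c : R, forall t, 0 <= t < 1 ->
    measurable_fun setT (J t) /\ (\int[P]_w ((J t w - k0) ^+ 2)%:E <= c%:E)%E.
Proof.
move=> FT FM pE JE bmo; have [c cP] := BMO2_L2_bound FT FM bmo.
case: bmo => _ [_ [_ [mJ _]]]; exists c => t t01; split.
  have -> : J t = fun w => (J t w - p w) + p0.
    by apply/funext => w; rewrite pE subrK.
  apply: measurable_funD; last exact: measurable_cst.
  by case: (mJ t t01).
apply: le_trans (cP t t01); rewrite le_eqVlt; apply/orP; left; apply/eqP.
by apply: eq_integral => w _; rewrite pE JE; congr (EFin (_ ^+ 2)); ring.
Qed.

(** Young's inequality 2 kap X G <= X^2 + kap^2 G^2 takes the place of Cauchy-Schwarz. Integrated,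
    it reads 2 kap^2 S <= 2c + 2 k0^2 + kap^2 (S + 16), and one copy of kap^2 S is absorbed on the
    left. *)
Lemma test_sum_bound (X G : T -> R) (c k0 kap S C M : R) :
  measurable_fun setT X -> measurable_fun setT G ->
  (forall w, `|X w| <= C) -> (forall w, `|G w| <= M) -> 0 < kap ->
  (\int[P]_w ((X w - k0) ^+ 2)%:E <= c%:E)%E ->
  \int[P]_w (G w ^+ 2) <= S + 16 ->
  kap * S <= \int[P]_w (X w * G w) ->
  S <= (2 * c + 2 * k0 ^+ 2 + 16 * kap ^+ 2) / kap ^+ 2.
Proof.
move=> mX mG XC GM kap0 EX EG EXG.
have iXk : P.-integrable setT (EFin \o (fun w => (X w - k0) ^+ 2)).
  apply: (@bounded_expectation_integrable _ _ _ _ _ ((C + `|k0|) ^+ 2)) => [|w].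
    by apply: measurable_funX; exact: measurable_funB.
  rewrite normrX lerXn2r ?nnegrE ?addr_ge0 ?(le_trans _ (XC w))//.
  by apply: le_trans (ler_normB _ _) _; rewrite lerD2r.
have iXG : P.-integrable setT (EFin \o (fun w => X w * G w)).
  apply: (@bounded_expectation_integrable _ _ _ _ _ (C * M)) => [|w].
    exact: measurable_funM.
  by rewrite normrM ler_pM.
have iG2 : P.-integrable setT (EFin \o (fun w => G w ^+ 2)).
  apply: (@bounded_expectation_integrable _ _ _ _ _ (M ^+ 2)) => [|w].
    exact: measurable_funX.
  by rewrite normrX lerXn2r ?nnegrE// (le_trans _ (GM w)).
have {}EX : \int[P]_w ((X w - k0) ^+ 2) <= c.
  by rewrite -lee_fin /Rintegral fineK//; exact: integrable_fin_num iXk.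
have quad : 2 * kap * \int[P]_w (X w * G w) <=
    2 * \int[P]_w ((X w - k0) ^+ 2) + 2 * k0 ^+ 2 + kap ^+ 2 * \int[P]_w (G w ^+ 2).
  have i1 : P.-integrable setT (EFin \o (fun w => 2 * (X w - k0) ^+ 2)).
    by rewrite /comp; under eq_fun do rewrite EFinM; exact: integrableZl.
  have i2 : P.-integrable setT (EFin \o (fun=> 2 * k0 ^+ 2)).
    exact: (@bounded_expectation_integrable _ _ _ P (cst (2 * k0 ^+ 2))
      `|2 * k0 ^+ 2| (measurable_cst _) (fun=> lexx _)).
  have i3 : P.-integrable setT (EFin \o (fun w => kap ^+ 2 * G w ^+ 2)).
    by rewrite /comp; under eq_fun do rewrite EFinM; exact: integrableZl.
  have i12 : P.-integrable setT (EFin \o (fun w => 2 * (X w - k0) ^+ 2 + 2 * k0 ^+ 2)).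
    by rewrite /comp; under eq_fun do rewrite EFinD; exact: integrableD.
  rewrite -(RintegralZl _ measurableT iXk) -(RintegralZl _ measurableT iG2).
  rewrite -[X in _ + X + _](expectation_cst P) -(RintegralD measurableT i1 i2).
  rewrite -(RintegralD measurableT i12 i3) -(RintegralZl _ measurableT iXG).
  apply: le_Rintegral => //.
  - by rewrite /comp; under eq_fun do rewrite EFinM; exact: integrableZl.
  - by rewrite /comp; under eq_fun do rewrite EFinD; exact: integrableD.
  (* The first square is 2(X - k0)^2 + 2 k0^2 - X^2, the second is Young's inequality; their sum is
     the claim. *)
  move=> w _; have := sqr_ge0 (X w - 2 * k0); have := sqr_ge0 (X w - kap * G w).
  by rewrite !sqrrB !exprMn; lra.
rewrite ler_pdivlMr ?exprn_gt0//.
have k2 : 0 <= kap ^+ 2 by exact: sqr_ge0.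
have h1 : 2 * kap * (kap * S) <= 2 * kap * \int[P]_w (X w * G w).
  by rewrite ler_wpM2l// mulr_ge0// ltW.
have h2 : kap ^+ 2 * \int[P]_w (G w ^+ 2) <= kap ^+ 2 * (S + 16) by rewrite ler_wpM2l.
have e1 : 2 * kap * (kap * S) = 2 * (S * kap ^+ 2) by ring.
have e2 : kap ^+ 2 * (S + 16) = S * kap ^+ 2 + 16 * kap ^+ 2 by ring.
by rewrite e1 in h1; rewrite e2 in h2; lra.
Qed.

Lemma aug_filtrationT (W : R -> T -> R) (t : R) : aug_filtration P W t setT.
Proof. by move=> C [[C0 CD _] _]; rewrite -(setD0 setT); exact: CD. Qed.

Lemma aug_filtration_le (W : R -> T -> R) (s t : R) : s <= t ->
  aug_filtration P W s `<=` aug_filtration P W t.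
Proof.
move=> st; apply: sub_sigma_algebra2 => A [[u [A' [us h]]]|h]; [left|by right].
by exists u, A'; split => //; have /andP[-> /le_trans ->] := us.
Qed.

End BMO.

(** * Contradiction with the divergence of the harmonic series *)

Unset Implicit Arguments.

Theorem theorem5p1 (R : realType) (d : measure_display) (T : measurableType d)
  (P : probability T R) (W : R -> T -> R)
  (P_complete : measure_is_complete P)
  (W_bm : is_brownian P W)
  (F_eq_F1 : forall A : set T, measurable A <-> aug_filtration P W 1 A)
  (theta : R) (q : \bar R)
  (htheta : 0 < theta < 1) (hq : (2%:E < q)%E) :
  let alpha := (1 - theta) / 2 in
  exists f : R -> R,
    interp_space theta q f /\
    ~ in_BMO2 P (aug_filtration P W)
        (fun t w => frac_I alpha (phi P W f) t w - phi P W f 0 w).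
Proof.
move=> alpha.
have [b [B [D [B4 D4 bBD Bdef Ddef]]]] := exists_lacunary_base htheta.
exists (lacunary B b); split; first exact: lacunary_interp htheta B4 D4 bBD Bdef _ hq.
move=> bmo; set f := lacunary B b in bmo.
have W0 w : W 0 w = 0 by case: W_bm => _ [h _].
(* Since W_0 = 0, the gradient at time 0 is a constant, and so is the fractional integral stopped at
   0. *)
pose p0 := derive1 (heatF P W f 0) 0.
have phi0 w : phi P W f 0 w = p0 by rewrite /phi W0.
pose k0 := alpha * \int[lebesgue_measure]_(u in `[0, 1]) ((1 - u) `^ (alpha - 1) * p0).
have I0 w : frac_I alpha (phi P W f) 0 w = k0.
  have E : \int[lebesgue_measure]_(u in `[0, 1])
        ((1 - u) `^ (alpha - 1) * phi P W f (Num.min u 0) w) =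
      \int[lebesgue_measure]_(u in `[0, 1]) ((1 - u) `^ (alpha - 1) * p0).
    apply: eq_Rintegral => u; rewrite inE/= in_itv/= => /andP[u0 _].
    by rewrite (min_r u0) phi0.
  by rewrite /k0 -E.
(* The time-0 augmentation contains all subsets of null sets; they are measurable because the whole
   sigma-algebra is the augmented one at time 1. *)
have FM A : aug_filtration P W 0 A -> measurable A.
  by move=> FA; apply/F_eq_F1; exact: aug_filtration_le ler01 _ FA.
have [c cP] := BMO2_shift_L2_bound (@aug_filtrationT _ _ _ P W 0) FM phi0 I0 bmo.
have a0 : 0 < alpha by rewrite /alpha; have /andP[? ?] := htheta; lra.
pose kap := alpha * (expR (-1) / 2).
have kap0 : 0 < kap by rewrite /kap mulr_gt0// divr_gt0 ?expR_gt0.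
pose S N := \sum_(0 <= j < N) (weight j : R) ^+ 2.
have b4 : 4 <= b by rewrite bBD; nra.
suff SN N : S N <= (2 * c + 2 * k0 ^+ 2 + 16 * kap ^+ 2) / kap ^+ 2.
  apply: (@dvg_harmonic R); apply: nondecreasing_is_cvgn.
    by apply/nondecreasing_seqP => n; rewrite seriesS lerDr; exact: harmonic_ge0.
  exists ((2 * c + 2 * k0 ^+ 2 + 16 * kap ^+ 2) / kap ^+ 2) => _ [n _ <-].
  apply: le_trans (SN n); rewrite /series/= /S le_eqVlt; apply/orP; left; apply/eqP.
  by apply: eq_bigr => j _; rewrite weight_sqr.
(* The time depends on [N] but [c] does not: this is how one BMO bound controls all partial sums. *)
pose t := 1 - gap b N.
have t01 : 0 <= t < 1.
  have := gap_gt0 B4 D4 bBD N; have := gap_le1 B4 D4 bBD N.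
  by move=> h1 h2; apply/andP; split; rewrite /t; lra.
have [t0 t1] := andP t01.
have [mX EX] := cP t t01.
have mG := test_var_measurable W_bm b N.
have [JC _ _] := fractional_Fubini W_bm htheta B4 D4 bBD Ddef t0 t1 mG (test_var_bound W b N).
have tst := frac_kernel_test W_bm htheta B4 D4 bBD Ddef N.
have XE w := frac_kernelE P W theta b B t w.
rewrite -/t in tst; rewrite -/f -/alpha in XE.
move: XE JC tst EX mX; set X := frac_I alpha _ t; set J := frac_kernel _ _ _ _ _ t.
move: X J (_ * _ : R) => X J C XE JC tst EX mX.
have XC w : `|X w| <= alpha * C by rewrite XE normrM gtr0_norm// ler_wpM2l// ltW.
apply: (test_sum_bound mX mG XC (test_var_bound W b N) kap0 EX).
  exact: expectation_test_var_sqr.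
have JE : J = fun w => alpha^-1 * X w.
  by apply/funext => w; rewrite XE mulKf// gt_eqF.
have iXG : P.-integrable setT (EFin \o (fun w => X w * test_var W b N w)).
  apply: (@bounded_expectation_integrable _ _ _ _ _ (alpha * C * N%:R)) => [|w].
    exact: measurable_funM.
  by rewrite normrM ler_pM//; exact: test_var_bound.
have JG w : J w * test_var W b N w = alpha^-1 * (X w * test_var W b N w).
  by rewrite JE mulrA.
(* [frac_kernel] omits the prefactor alpha of the fractional integral; restoring it accounts for the
   alpha in [kap]. *)
move: tst; under eq_integral do rewrite JG EFinM.
rewrite integralZl// -(fineK (integrable_fin_num measurableT iXG)) -EFinM lee_fin.
by rewrite ler_pdivlMl// mulrA.
Qed.
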